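(* Let $C(z)=\frac{1-\sqrt{1-4z}}{2z}=\sum_{n\ge 0}\operatorname{Cat}(n)z^n$ be the generating function of the Catalan numbers, and for $\xi\ge 0$ let $W_\xi(z)=\sum_{\ell\ge 0}\frac{w_{\ell-\xi+1,2\ell}}{(\ell-\xi+1)!}z^\ell$ be the generating function of tree walks of excess $\xi$. Then $W_0(z)=C(z)$, and for every $\xi\ge 1$ there are polynomials $(K_{\xi,s}(x))_{0\le s\le 2\xi-2}$ with non-negative coefficients, $K_{\xi,s}$ of degree $2\xi+s$, such that \[ W_\xi(z)=C(z)\sum_{s=0}^{2\xi-2}\frac{K_{\xi,s}\big(zC(z)^2\big)}{\big(1-zC(z)^2\big)^{s+1}}. \] Moreover $K_{\xi,2\xi-2}(x)=\operatorname{Cat}(\xi-1)x^{4\xi-2}$ for all $\xi\ge 1$, and $K_{\xi,2\xi-3}(x)=(3\xi-1)\operatorname{Cat}(\xi-1)x^{4\xi-3}$ for all $\xi\ge 2$.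
   Context: A tree walk of size $m$ and length $L$ is a sequence $W=(v_1,\dots,v_L)$ of elements of $[m]=\{1,\dots,m\}$ in which every element of $[m]$ occurs, such that the graph $T(W)$ with vertex set $[m]$ and edge set $\{\{v_j,v_{j+1}\}:1\le j<L\}\cup\{\{v_L,v_1\}\}$ is a tree; $W$ is regarded as the closed walk $v_1\to v_2\to\dots\to v_L\to v_1$ and $v_1$ is the root of $T(W)$. By convention the one-vertex walk of length $0$ is a tree walk of size $1$. Every tree walk has even length. $w_{m,2\ell}$ denotes the number of tree walks of size $m$ and length $2\ell$, with $w_{1,0}=1$, $w_{0,0}=0$, $w_{0,2\ell}=w_{1,2\ell}=0$ for $\ell\ge 1$, and $w_{m,2\ell}=0$ whenever $m<0$. Each edge of $T(W)$ is traversed $2k$ times ($k\ge1$) by the closed walk; its excess is $k-1$. The excess of $W$ is the sum of the excesses of the edges of $T(W)$, equal to $\ell-(m-1)$ for a walk of length $2\ell$ and size $m$. $\operatorname{Cat}(n)=\frac{1}{n+1}\binom{2n}{n}$. *)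

(* Defs.v *)
From HB Require Import structures.
From mathcomp Require Import all_boot all_order all_algebra.
Set Implicit Arguments. Unset Strict Implicit. Unset Printing Implicit Defensive.
Import Order.TTheory GRing.Theory Num.Theory.

Definition walk_pairs (T : Type) (s : seq T) : seq (T * T) := zip s (rot 1 s).

Definition walk_adj (m : nat) (s : seq 'I_m) : rel 'I_m :=
  fun x y => has (fun p : 'I_m * 'I_m =>
                    ((p.1 == x) && (p.2 == y)) || ((p.1 == y) && (p.2 == x)))
                 (walk_pairs s).

Definition walk_loopfree (m : nat) (s : seq 'I_m) : bool :=
  all (fun p : 'I_m * 'I_m => p.1 != p.2) (walk_pairs s).

Definition graph_connected (m : nat) (e : rel 'I_m) : bool :=
  [forall x, forall y, connect e x y].

(* no cycle of >= 3 distinct vertices (a cycle of distinct vertices of 'I_m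
   has at most m vertices) *)
Definition graph_acyclic (m : nat) (e : rel 'I_m) : bool :=
  [forall k : 'I_m.+1, forall c : k.-tuple 'I_m,
     ~~ [&& 2 < k, uniq c & cycle e c]].

Definition is_tree_walk (m : nat) (s : seq 'I_m) : bool :=
  if s is [::] then m == 1   (* convention: one-vertex walk of length 0 *)
  else [&& [forall v : 'I_m, v \in s], walk_loopfree s,
           graph_connected (walk_adj s) & graph_acyclic (walk_adj s)].

Definition w (m L : nat) : nat :=
  #|[set t : L.-tuple 'I_m | is_tree_walk t]|.

Definition fps := nat -> rat.

Definition fone : fps := fun n => if n == 0%N then 1%R else 0%R.
Definition fX : fps := fun n => if n == 1%N then 1%R else 0%R.

Definition fmul (f g : fps) : fps :=
  fun n => (\sum_(i < n.+1) f i * g (n - i)%N)%R.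

Definition fpow (f : fps) (k : nat) : fps := iter k (fmul f) fone.

(* 1/(1-h) = sum_k h^k, for h with zero constant term *)
Definition fgeom (h : fps) : fps :=
  fun n => (\sum_(k < n.+1) fpow h k n)%R.

Definition peval (p : {poly rat}) (h : fps) : fps :=
  fun n => (\sum_(i < size p) p`_i * fpow h i n)%R.

Definition Cat (n : nat) : rat := ('C(2 * n, n)%:R / n.+1%:R)%R.

Definition Cgf : fps := fun n => Cat n.

Definition Wgf (xi : nat) : fps :=
  fun l => if (xi <= l)%N
           then ((w (l.+1 - xi) (2 * l))%:R / ((l.+1 - xi)`!)%:R)%R
           else 0%R.

(* Main.v *)
Require Import Defs.
From HB Require Import structures.
From mathcomp Require Import fingroup perm.
From mathcomp Require Import all_boot all_order all_algebra.
From mathcomp Require Import boolp.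
From mathcomp Require Import ring zify.
Import Order.TTheory GRing.Theory Num.Theory.
Set Implicit Arguments.
Unset Strict Implicit.
Unset Printing Implicit Defensive.

(** A tree walk that visits its root several times is a word of trees; the walk
  is cut at its visits to the root by separators.  Removing all the children of
  the root carrying the same label as the first one shows that the generating
  functions [B_k] of words with [k - 1] separators, with [u] marking the excess
  and [z] half the length, satisfy [B_0 = 1] and
    [B_(k+1) = B_k + sum_i 'C(i+k, i) u^i z^(i+1) B_(i+1) B_(i+k+1)],
  the binomial coefficient counting how the removed children are interleaved
  with the separators.  Labels contribute the factor [m`!], since every label
  is visited.  With [x = z C^2], [q = 1 / (1 - x)], the substitution
  [B_k = (C G)^k beta_k] and [B_1 = C (1 + u V)], [G = 1 / (1 - x u V)], turns
  this into a system without the variable [z], whose unique solution has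
  coefficients in [Q[x][q]]: the coefficient of [q^(s+1)] in the excess [xi]
  part of [u V] is [K_(xi,s)].  Positivity and degrees are read off the system,
  and its two leading terms in [q] satisfy a quadratic and a linear equation
  solved by Catalan numbers. *)

(** * Words of labelled trees *)

(** The traversals of one edge are spread over several visits to its upper end, so the forests met
    at these visits cannot be described independently; words with separators, unlike single trees,
    satisfy a closed recurrence. The substitution comes from the summand [z B_1 B_(k+1)] at [i = 0].
    Moved to the left, it makes each step contribute [1 / (1 - z B_1)], which for
    [B_1 = C (1 + u V)] equals [C / (1 - x u V) = C G], because [1 - z C = 1 / C]. As [x q = q - 1],
    an expansion in [x] and [q] is not unique, and the prescribed leading terms depend on the form
    of the equation for [V]. With [v = u V], the direct equation [(1 - x) v = x v^2 + beta_1 - 1]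
    would give other exponents; the system uses its consequence
    [(1 - x) v = G (x^2 v^2 + beta_1 - 1)]. The system is not derived from the recurrence. It is
    solved over polynomials in independent [x] and [q], where degrees make sense; the solution is
    evaluated at power series and checked against the recurrence, which has only one solution
    because each of its products carries a factor [z]. *)

Section Trees.
Variable T : Type.

Inductive tree := Node of T & seq tree.

HB.instance Definition _ := gen_eqMixin tree.

Lemma tree_ind_in (Q : tree -> Prop) :
  (forall c g, (forall t, t \in g -> Q t) -> Q (Node c g)) -> forall t, Q t.
Proof.
move=> QN; fix rec 1 => -[c g]; apply: QN.
elim: g => [|t g IHg] s; first by move=> s0; case: (notF s0).
by rewrite inE => /predU1P [->|sg]; [apply: (rec t)|apply: (IHg s)].
Qed.

(* [None] separates consecutive visits to the common root of the trees. *)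
Definition word := seq (option tree).

Definition troot t := let: Node c _ := t in c.

Fixpoint tedges t := let: Node _ g := t in (sumn (map tedges g)).+1.
Definition wedges (w : word) := sumn (map (oapp tedges 0) w).

(** The start [v] is left out and the final return to [v] is kept, so that the walks of successive
    trees at [v] concatenate. *)
Fixpoint twalk v t := let: Node c g := t in c :: flatten (map (twalk c) g) ++ [:: v].
Definition wwalk v (w : word) := flatten (map (oapp (twalk v) [::]) w).

Fixpoint tlabels t := let: Node c g := t in c :: flatten (map tlabels g).
Definition wlabels (w : word) := flatten (map (oapp tlabels [::]) w).

Fixpoint tok (P : rel T) v t := let: Node c g := t in P c v && all (tok P c) g.
Definition wok P v (w : word) := all (oapp (tok P v) true) w.

Definition isep (x : option tree) := if x is None then true else false.

Fixpoint chunk (w : word) := if w is Some t :: w' then t :: chunk w' else [::].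
Fixpoint unchunk (w : word) := if w is Some _ :: w' then unchunk w' else w.

Definition starts_sep (w : word) := if w is Some _ :: _ then false else true.

Lemma chunkK w : map Some (chunk w) ++ unchunk w = w.
Proof. by elim: w => // -[t|] w //= ->. Qed.

Lemma chunk_cat g w : starts_sep w -> chunk (map Some g ++ w) = g.
Proof. by case: w => [|[]] // => [_|w _]; elim: g => //= t g ->. Qed.

Lemma unchunk_cat g w : starts_sep w -> unchunk (map Some g ++ w) = w.
Proof. by case: w => [|[]] // => [_|w _]; elim: g => //= t g ->. Qed.

Lemma starts_unchunk w : starts_sep (unchunk w).
Proof. by elim: w => // -[]. Qed.

Lemma isep_map_Some g : count isep (map Some g) = 0.
Proof. by elim: g. Qed.

Lemma count_unchunk w : count isep (unchunk w) = count isep w.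
Proof. by rewrite -[in RHS](chunkK w) count_cat isep_map_Some. Qed.

(* Replaces the separators of [R] marked by [mask] with nodes labelled [c],
   whose subforests are the successive chunks of [H]. *)
Fixpoint weave c (mask : seq bool) (H R : word) : word :=
  match R, mask with
  | Some t :: R', _ => Some t :: weave c mask H R'
  | None :: R', true :: mask' => Some (Node c (chunk (behead H)))
                         :: weave c mask' (unchunk (behead H)) R'
  | None :: R', _ => None :: weave c (behead mask) H R'
  | [::], _ => [::]
  end.

Lemma sumn_cat_map (F : option tree -> nat) w w' :
  sumn (map F (w ++ w')) = sumn (map F w) + sumn (map F w').
Proof. by rewrite map_cat sumn_cat. Qed.

Lemma wedges_chunk w : sumn (map tedges (chunk w)) + wedges (unchunk w) = wedges w.
Proof.
by rewrite -[in RHS](chunkK w) /wedges sumn_cat_map -map_comp.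
Qed.

(** Each marked separator of [R] is traded for one edge and one chunk of [H]. As [H] starts with a
    separator, it has exactly one chunk per separator. *)
Lemma weave_stats c mask H R : starts_sep H ->
    count isep H = count id mask -> count isep R = size mask ->
  count isep (weave c mask H R) = count negb mask /\
  wedges (weave c mask H R) = count id mask + (wedges H + wedges R).
Proof.
elim: R mask H => [|[t|] R IHR] mask H sH /=.
- case: mask => [|//]; case: H sH => [|[]] //.
- move=> Hm Rm; have [-> E] := IHR mask H sH Hm Rm; split=> //.
  by rewrite /wedges /= -!/(wedges _) E; lia.
- case: mask => [//|[] mask] /= Hm [Rm]; last first.
    by have [-> E] := IHR mask H sH Hm Rm.
  case: H sH Hm => [//|[//|] H] _ /= [Hm].
  have := IHR mask (unchunk H) (starts_unchunk H).
  rewrite count_unchunk => /(_ Hm Rm) [-> E]; split=> //.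
  rewrite /wedges /= -!/(wedges _) E -[in RHS](wedges_chunk H); lia.
Qed.

Lemma wok_chunk P v w : wok P v w = all (tok P v) (chunk w) && wok P v (unchunk w).
Proof. by rewrite -[in LHS](chunkK w) /wok all_cat all_map. Qed.

Lemma weave_ok (P : rel T) c v mask H R : P c v -> wok P c H -> wok P v R ->
  wok P v (weave c mask H R).
Proof.
move=> Pcv; elim: R mask H => //= -[t|] R IHR mask H Hok.
  by move=> /= /andP [-> /(IHR mask H Hok)].
case: mask => [|[] mask] /= Rok; try exact: IHR.
have Hok' : wok P c (behead H) by case: H Hok => //= x H /andP [].
by move: Hok'; rewrite wok_chunk => /andP [-> /IHR -> //]; rewrite Pcv.
Qed.

End Trees.

(** * Taking a word apart at the trees with a given root label *)

Section Unweave.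
Variable T : eqType.
Implicit Types (c d v : T) (w : word T) (t : tree T).

(** [gather], [hole] and [holes] recover the arguments [H], [R] and [mask] of [weave]. Every
    subforest is preceded by its own separator, so that the children of a first tree, kept apart,
    can be put in front. *)
Fixpoint gather c w : word T := match w with
  | Some (Node d g) :: w' => if d == c then None :: map Some g ++ gather c w'
                             else gather c w'
  | None :: w' => gather c w'
  | [::] => [::] end.
Fixpoint hole c w : word T := match w with
  | Some (Node d g) :: w' => (if d == c then None else Some (Node d g)) :: hole c w'
  | None :: w' => None :: hole c w'
  | [::] => [::] end.
Fixpoint holes c w : seq bool := match w with
  | Some (Node d g) :: w' => if d == c then true :: holes c w' else holes c w'
  | None :: w' => false :: holes c w'
  | [::] => [::] end.

Lemma starts_gather c w : starts_sep (gather c w).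
Proof. by elim: w => // -[[d g]|] w //= IHw; case: eqP. Qed.

Lemma unweaveK c w : weave c (holes c w) (gather c w) (hole c w) = w.
Proof.
elim: w => // -[[d g]|] w //= IHw; last by rewrite IHw.
case: eqP => [->|_] /=; last by rewrite IHw.
by rewrite chunk_cat ?unchunk_cat ?starts_gather ?IHw.
Qed.

Lemma count_gather c w : count (@isep T) (gather c w) = count id (holes c w).
Proof.
elim: w => // -[[d g]|] w //= IHw; case: eqP => //= _.
by rewrite count_cat isep_map_Some IHw.
Qed.

Lemma count_hole c w : count (@isep T) (hole c w) = size (holes c w).
Proof. by elim: w => // -[[d g]|] w //= IHw; rewrite IHw //; case: eqP. Qed.

Definition notop c w := all (oapp (fun t => troot t != c) true) w.

Lemma notop_hole c w : notop c (hole c w).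
Proof. by elim: w => // -[[d g]|] w //= ->; rewrite andbT; case: eqP => //= /eqP. Qed.

(** A top-level tree of [R] with root [c] would be mistaken for a filled hole, hence [notop]. *)
Lemma weaveK c mask H R : starts_sep H -> notop c R ->
    count (@isep T) H = count id mask -> count (@isep T) R = size mask ->
  [/\ holes c (weave c mask H R) = mask, gather c (weave c mask H R) = H
    & hole c (weave c mask H R) = R].
Proof.
elim: R mask H => [|[[d g]|] R IHR] mask H sH /=.
- by case: mask => [|//] _; case: H sH => [|[]].
- move=> /andP [/negbTE dc nR] Hm Rm; rewrite dc.
  by have [-> -> ->] := IHR mask H sH nR Hm Rm.
- case: mask => [//|[] mask] nR /= Hm [Rm]; last first.
    by have [-> -> ->] := IHR mask H sH nR Hm Rm.
  case: H sH Hm => [//|[//|] H] _ /= [Hm]; rewrite eqxx.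
  have := IHR mask (unchunk H) (starts_unchunk H) nR.
  rewrite count_unchunk => /(_ Hm Rm) [-> -> ->].
  by rewrite chunkK.
Qed.

Lemma wok_gather P c v w : wok P v w -> wok P c (gather c w).
Proof.
elim: w => // -[[d g]|] w IHw //= /andP [/andP [_ gok] /IHw wok_w].
case: eqP => [dc|//]; rewrite -dc in wok_w *; rewrite /wok /= all_cat all_map.
by apply/andP.
Qed.

Lemma wok_hole P c v w : wok P v w -> wok P v (hole c w).
Proof. by elim: w => // -[[d g]|] w IHw //= /andP [dok /IHw ->]; case: eqP => //=; rewrite dok. Qed.

Lemma wlabels_cons x w : wlabels (x :: w) = oapp (@tlabels T) [::] x ++ wlabels w.
Proof. by []. Qed.

Lemma wlabels_cat w w' : wlabels (w ++ w') = wlabels w ++ wlabels w'.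
Proof. by rewrite /wlabels map_cat flatten_cat. Qed.

Lemma wlabels_chunk d w :
  (d \in wlabels w) = (d \in flatten (map (@tlabels T) (chunk w))) || (d \in wlabels (unchunk w)).
Proof.
by rewrite -[in LHS](chunkK w) wlabels_cat mem_cat {1}/wlabels -map_comp.
Qed.

Lemma weave_labels c d mask H R : starts_sep H ->
    count (@isep T) H = count id mask -> count (@isep T) R = size mask ->
  (d \in wlabels H) || (d \in wlabels R) -> d \in wlabels (weave c mask H R).
Proof.
elim: R mask H => [|[t|] R IHR] mask H sH /=.
- by case: mask => [|//]; case: H sH => [|[]].
- move=> Hm Rm; rewrite !wlabels_cons !mem_cat orbCA => /orP [-> //|/(IHR mask H sH Hm Rm) ->].
  by rewrite orbT.
- case: mask => [//|[] mask] /= Hm [Rm]; last exact: IHR.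
  case: H sH Hm => [//|[//|] H] _ /= [Hm].
  have := IHR mask (unchunk H) (starts_unchunk H).
  rewrite count_unchunk => /(_ Hm Rm) IH.
  rewrite !wlabels_cons /= inE mem_cat wlabels_chunk -orbA => /orP [->|/IH ->];
    by rewrite ?orbT.
Qed.

Lemma tok_labels P v t : tok P v t -> {in tlabels t, forall d, exists e, P d e}.
Proof.
elim/tree_ind_in: t v => c g IHg v /= /andP [Pcv gok] d; rewrite inE.
case/predU1P => [->|/flatten_mapP [t tg dt]]; first by exists v.
exact: (IHg t tg c ((allP gok) t tg) d dt).
Qed.

Lemma wok_labels P v w : wok P v w -> {in wlabels w, forall d, exists e, P d e}.
Proof.
move=> wokw d /flatten_mapP [[t|] // tw dt].
exact: (tok_labels (v := v) (allP wokw _ tw)).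
Qed.

End Unweave.

(** * Relabelling trees and words *)

Section Relabel.
Variables (S T : Type) (f : S -> T).

Fixpoint tmap t := let: Node c g := t in Node (f c) (map tmap g).
Definition wmap (w : word S) : word T := map (omap tmap) w.

Lemma count_isep_wmap w : count (@isep T) (wmap w) = count (@isep S) w.
Proof. by rewrite /wmap count_map; apply: eq_count => -[]. Qed.

Lemma starts_wmap w : starts_sep (wmap w) = starts_sep w.
Proof. by case: w => [|[]]. Qed.

Lemma chunk_wmap w : chunk (wmap w) = map tmap (chunk w).
Proof. by elim: w => // -[t|] w //= ->. Qed.

Lemma unchunk_wmap w : unchunk (wmap w) = wmap (unchunk w).
Proof. by elim: w => // -[t|] w //= ->. Qed.

Lemma weave_wmap c mask H R :
  wmap (weave c mask H R) = weave (f c) mask (wmap H) (wmap R).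
Proof.
elim: R mask H => //= -[t|] R IHR mask H /=; first by rewrite IHR.
have Hb : behead (wmap H) = wmap (behead H) by case: H.
by case: mask => [|[] mask] /=; rewrite IHR // Hb chunk_wmap unchunk_wmap.
Qed.

Lemma tedges_tmap t : tedges (tmap t) = tedges t.
Proof.
elim/tree_ind_in: t => c g IHg /=; congr (sumn _).+1.
by rewrite -map_comp; apply/eq_in_map => t /IHg.
Qed.

Lemma wedges_wmap w : wedges (wmap w) = wedges w.
Proof.
by rewrite /wedges /wmap -map_comp; congr sumn; apply: eq_map => -[t|] //=; apply: tedges_tmap.
Qed.

Lemma twalk_tmap v t : twalk (f v) (tmap t) = map f (twalk v t).
Proof.
elim/tree_ind_in: t v => c g IHg v /=; rewrite map_cat map_flatten -!map_comp.
by congr (_ :: flatten _ ++ _); apply/eq_in_map => t /IHg /(_ c).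
Qed.

Lemma wwalk_wmap v w : wwalk (f v) (wmap w) = map f (wwalk v w).
Proof.
rewrite /wwalk /wmap map_flatten -!map_comp; congr flatten.
by apply: eq_map => -[t|] //=; apply: twalk_tmap.
Qed.

Lemma tok_tmap (P : rel S) (P' : rel T) v t :
  (forall c d, P c d -> P' (f c) (f d)) -> tok P v t -> tok P' (f v) (tmap t).
Proof.
move=> PP'; elim/tree_ind_in: t v => c g IHg v /= /andP [/PP' -> gok] /=.
by rewrite all_map; apply/allP => t tg; apply: (IHg t tg c); apply: (allP gok).
Qed.

Lemma wok_wmap (P : rel S) (P' : rel T) v w :
  (forall c d, P c d -> P' (f c) (f d)) -> wok P v w -> wok P' (f v) (wmap w).
Proof.
move=> PP' /allP wokw; rewrite /wok all_map; apply/allP => -[t|] //= tw.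
exact: tok_tmap PP' (wokw _ tw).
Qed.

End Relabel.

Lemma eq_in_tmap (S : eqType) T (f g : S -> T) t :
  {in tlabels t, f =1 g} -> tmap f t = tmap g t.
Proof.
elim/tree_ind_in: t => c s IHs fg /=; congr Node; first by apply: fg; apply: mem_head.
apply/eq_in_map => t ts; apply: IHs => // d dt; apply: fg.
by rewrite inE; apply/orP; right; apply/flatten_mapP; exists t.
Qed.

Lemma eq_in_wmap (S : eqType) T (f g : S -> T) w :
  {in wlabels w, f =1 g} -> wmap f w = wmap g w.
Proof.
move=> fg; apply/eq_in_map => -[t|] //= tw; congr Some; apply: eq_in_tmap => d dt.
by apply: fg; apply/flatten_mapP; exists (Some t).
Qed.

Lemma wmap_comp (R S T : Type) (f : S -> T) (g : R -> S) w :
  wmap f (wmap g w) = wmap (f \o g) w.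
Proof.
rewrite /wmap -map_comp; apply: eq_map => -[t|] //=; congr Some.
by elim/tree_ind_in: t => c s IHs /=; congr Node; rewrite -map_comp; apply/eq_in_map.
Qed.

Lemma tlabels_tmap (S T : Type) (f : S -> T) t : tlabels (tmap f t) = map f (tlabels t).
Proof.
elim/tree_ind_in: t => c g IHg /=; rewrite map_flatten -!map_comp.
by congr (_ :: flatten _); apply/eq_in_map => t /IHg.
Qed.

Lemma wlabels_wmap (S T : Type) (f : S -> T) w : wlabels (wmap f w) = map f (wlabels w).
Proof.
rewrite /wlabels /wmap map_flatten -!map_comp; congr flatten.
by apply: eq_map => -[t|] //=; apply: tlabels_tmap.
Qed.

(** * Codes of tree walks *)

(* [CNode mask c1 c2] encodes a word whose first tree has root [c]: [c1] encodes
   the subforests of all the trees with root [c], [c2] the word in which the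
   other trees with root [c] are replaced by separators, and [mask] tells these
   separators from the original ones. *)
Inductive code := CNil | CSep of code | CNode of seq bool & code & code.

HB.instance Definition _ := gen_eqMixin code.

Fixpoint nsep c := match c with
  | CNil => 0 | CSep c => (nsep c).+1 | CNode mask _ _ => count negb mask end%N.
Fixpoint nvert c := match c with
  | CNil => 1 | CSep c => nvert c | CNode _ c1 c2 => nvert c1 + nvert c2 end%N.
Fixpoint nedge c := match c with
  | CNil => 0 | CSep c => nedge c
  | CNode mask c1 c2 => (count id mask).+1 + (nedge c1 + nedge c2) end%N.
Fixpoint excess c := match c with
  | CNil => 0 | CSep c => excess c
  | CNode mask c1 c2 => count id mask + (excess c1 + excess c2) end%N.
Fixpoint wf c := match c with
  | CNil => true | CSep c => wf c
  | CNode mask c1 c2 => [&& wf c1, wf c2, nsep c1 == count id mask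
                          & nsep c2 == size mask] end.

(** [nedge] counts the edges with multiplicity and [excess] the repetitions; their difference is the
    number of distinct edges of a tree. *)
Lemma nvert_excess c : (nvert c + excess c = (nedge c).+1)%N.
Proof. by elim: c => //= mask c1 IH1 c2 IH2; lia. Qed.

Lemma nvert_gt0 c : (0 < nvert c)%N.
Proof. by elim: c => //= mask c1 IH1 c2 IH2; lia. Qed.

(** * Enumerating the codes *)

Section Flatten.
Variables (I J : eqType) (F : I -> seq J).

(** [key] recovers the index from an element, so the lists joined together are disjoint. *)
Lemma flatten_map_uniq (key : J -> I) (s : seq I) : uniq s ->
  {in s, forall i, uniq (F i) /\ {in F i, forall y, key y = i}} ->
  uniq (flatten [seq F i | i <- s]).
Proof.
move=> us; elim: s us => //= i s IHs /andP [is_ us] sF.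
have [uF kF] := sF i (mem_head _ _).
have {}sF : {in s, forall i, uniq (F i) /\ {in F i, forall y, key y = i}}.
  by move=> j js; apply: sF; rewrite inE js orbT.
rewrite cat_uniq uF IHs // andbT; apply/hasPn => y /flatten_mapP [j js yj].
by apply: contra is_ => yi; rewrite -(kF _ yi) ((sF j js).2 _ yj).
Qed.

End Flatten.

Lemma size_flatten_iota (J : Type) n (F : nat -> seq J) :
  size (flatten [seq F i | i <- iota 0 n]) = (\sum_(i < n) size (F i))%N.
Proof.
rewrite size_flatten /shape -map_comp sumnE big_map -{1}[n]subn0.
by rewrite -/(index_iota 0 n) big_mkord.
Qed.

Fixpoint masks n a : seq (seq bool) :=
  if n is n'.+1 then
    [seq false :: s | s <- masks n' a]
      ++ (if a is a'.+1 then [seq true :: s | s <- masks n' a'] else [::])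
  else if a is 0 then [:: [::]] else [::].

Lemma mem_masks n a s : (s \in masks n a) = (size s == n) && (count id s == a).
Proof.
elim: n a s => [|n IHn] a s; first by case: a s => [|a] [|b s].
have cM b (m : seq (seq bool)) s' :
    (s' \in [seq b :: x | x <- m]) = (ohead s' == Some b) && (behead s' \in m).
  apply/mapP/andP => [[x xm ->]|]; first by rewrite /= eqxx.
  by case: s' => [[]//|b' s' [/= /eqP [->] ?]]; exists s'.
case: a => [|a]; rewrite /= mem_cat !cM; case: s => [|[] s] //=.
- by rewrite andbF.
- by rewrite IHn orbF.
- by rewrite IHn orbF.
Qed.

Lemma uniq_masks n a : uniq (masks n a).
Proof.
elim: n a => [|n IHn] [|a] //=; rewrite ?cats0 ?cat_uniq ?map_inj_uniq ?IHn //=;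
  try by move=> ? ? [].
rewrite andbT; apply/hasPn => _ /mapP [s _ ->]; apply/negP => /mapP [s' _ //].
Qed.

Lemma size_masks n a : size (masks n a) = 'C(n, a).
Proof.
by elim: n a => [|n IHn] [|a] //=; rewrite size_cat ?size_map !IHn ?bin0 // binS.
Qed.

Definition node_codes (E : nat -> nat -> nat -> seq code) (k x l : nat) :=
  flatten [seq flatten [seq flatten [seq flatten [seq
      [seq CNode mask c1 c2 | c1 <- E i x1 l1,
                              c2 <- E (i + k) (x - i - x1) (l - i.+1 - l1)]
    | l1 <- iota 0 (l - i)]
    | x1 <- iota 0 (x - i).+1]
    | mask <- masks (i + k) i]
    | i <- iota 0 x.+1]%N.

(* The codes with [k] separators, excess [x] and [l] edges, provided [l <= n]. *)
Fixpoint codes (n : nat) := fix codes_n (k x l : nat) : seq code :=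
  (if k is k'.+1 then [seq CSep c | c <- codes_n k' x l]
   else if (x == 0%N) && (l == 0%N) then [:: CNil] else [::]) ++
  (if n is n'.+1 then node_codes (codes n') k x l else [::]).

Lemma codesE n k x l : codes n k x l =
  (if k is k'.+1 then [seq CSep c | c <- codes n k' x l]
   else if (x == 0%N) && (l == 0%N) then [:: CNil] else [::]) ++
  (if n is n'.+1 then node_codes (codes n') k x l else [::]).
Proof. by case: n k => [|n] [|k]. Qed.

Lemma node_codesP E k x l c : reflect
  (exists mask c1 c2 x1 l1, [/\ c = CNode mask c1 c2, size mask = (count id mask + k)%N,
      c1 \in E (count id mask) x1 l1,
      c2 \in E (count id mask + k)%N (x - count id mask - x1)%N (l - (count id mask).+1 - l1)%N
    & (count id mask + x1 <= x)%N && ((count id mask).+1 + l1 <= l)%N])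
  (c \in node_codes E k x l).
Proof.
apply: (iffP flatten_mapP) => [[i]|[mask [c1 [c2 [x1 [l1 [-> sm c1E c2E xl]]]]]]].
  rewrite mem_iota => ix /flatten_mapP [mask].
  rewrite mem_masks => /andP [/eqP sm /eqP ci] /flatten_mapP [x1].
  rewrite mem_iota => x1x /flatten_mapP [l1]; rewrite mem_iota => l1l.
  move=> /allpairsP [[c1 c2] /= [c1E c2E ->]].
  exists mask, c1, c2, x1, l1; rewrite ci; split=> //; lia.
exists (count id mask); first by rewrite mem_iota; lia.
apply/flatten_mapP; exists mask; first by rewrite mem_masks sm !eqxx.
apply/flatten_mapP; exists x1; first by rewrite mem_iota; lia.
apply/flatten_mapP; exists l1; first by rewrite mem_iota; lia.
by apply/allpairsP; exists (c1, c2).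
Qed.

(** Every [CNode] uses an edge, so [l] units of fuel suffice; separators cost none, since the inner
    fixpoint descends on [k]. *)
Lemma mem_codes n k x l c : (l <= n)%N ->
  (c \in codes n k x l) = [&& wf c, nsep c == k, excess c == x & nedge c == l].
Proof.
have nodeF n' k' x' l' c' : (forall mask c1 c2, c' <> CNode mask c1 c2) ->
    (c' \in if n' is n''.+1 then node_codes (codes n'') k' x' l' else [::]) = false.
  by case: n' => // n' cN; apply/node_codesP => -[? [? [? [? [? [/cN]]]]]].
have sepP k' x' l' c' n' : (CSep c' \in codes n' k' x' l')
    = if k' is k''.+1 then c' \in codes n' k'' x' l' else false.
  rewrite codesE mem_cat nodeF // orbF.
  case: k' => [|k'] /=; first by case: (_ && _); rewrite // mem_seq1; apply/eqP.
  by rewrite mem_map // => ? ? [].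
have nilP k' x' l' n' : (CNil \in codes n' k' x' l')
    = [&& k' == 0, x' == 0 & l' == 0]%N.
  rewrite codesE mem_cat nodeF // orbF.
  case: k' => [|k'] /=; last by apply/mapP => [[]].
  by case: (_ && _); rewrite ?mem_head.
have nodeP k' x' l' n' mask c1 c2 : (CNode mask c1 c2 \in codes n' k' x' l')
    = if n' is n''.+1 then CNode mask c1 c2 \in node_codes (codes n'') k' x' l'
      else false.
  rewrite codesE mem_cat (_ : (_ \in _) = false); first by case: n'.
  case: k' => [|k']; last by apply/mapP => [[]].
  by case: (_ && _); rewrite // mem_seq1; apply/eqP.
elim: n k x l c => [|n IHn] k x l c; elim: c k => [|c IHc|mask c1 _ c2 _] k ln.
- by rewrite nilP /= (eq_sym k) (eq_sym x) (eq_sym l).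
- by rewrite sepP /=; case: k => [|k]; rewrite ?andbF // eqSS IHc.
- by rewrite nodeP /=; apply/esym/negbTE; lia.
- by rewrite nilP /= (eq_sym k) (eq_sym x) (eq_sym l).
- by rewrite sepP /=; case: k => [|k]; rewrite ?andbF // eqSS IHc.
have cm : (size mask = count id mask + count negb mask)%N.
  by rewrite -(count_predC id mask).
rewrite nodeP; apply/node_codesP/idP => /=.
  move=> [? [? [? [x1 [l1 [[<- <- <-] sm c1E c2E xl]]]]]].
  move: c1E c2E; rewrite !IHn; try lia.
move=> /and4P [/and4P [wf1 wf2 /eqP n1 /eqP n2] /eqP kE /eqP xE /eqP lE].
exists mask, c1, c2, (excess c1), (nedge c1); rewrite !IHn; try lia.
by rewrite wf1 wf2 n1 n2 !eqxx /=; split=> //; lia.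
Qed.

Lemma uniq_codes n k x l : (l <= n)%N -> uniq (codes n k x l).
Proof.
elim: n k x l => [|n IHn] k x l ln.
  by elim: k => [|k IHk]; rewrite codesE cats0 ?map_inj_uniq //; [case: (_ && _)|move=> ? ? []].
have uN k' : uniq (node_codes (codes n) k' x l).
  (* The four nested enumerations are told apart by the number of marks, the mask, and the excess
     and edge count of [c1]. *)
  apply: (flatten_map_uniq
    (key := fun c => if c is CNode mask c1 c2 then count id mask else 0%N)).
    exact: iota_uniq.
  move=> i _; split; last first.
    move=> c /flatten_mapP [mask + /flatten_mapP [x1 _ /flatten_mapP [l1 _]]].
    by rewrite mem_masks => /andP [_ /eqP ci] /allpairsP [[c1 c2] /= [_ _ ->]].
  apply: (flatten_map_uniq
    (key := fun c => if c is CNode mask c1 c2 then mask else [::])).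
    exact: uniq_masks.
  move=> mask _; split; last first.
    move=> c /flatten_mapP [x1 _ /flatten_mapP [l1 _]].
    by move=> /allpairsP [[c1 c2] /= [_ _ ->]].
  apply: (flatten_map_uniq
    (key := fun c => if c is CNode mask c1 c2 then excess c1 else 0%N)).
    exact: iota_uniq.
  move=> x1 _; split; last first.
    move=> c /flatten_mapP [l1 + /allpairsP [[c1 c2] /= [c1E _ ->]]].
    rewrite mem_iota => l1l; move: c1E; rewrite mem_codes; last by lia.
    by move=> /and4P [_ _ /eqP].
  apply: (flatten_map_uniq
    (key := fun c => if c is CNode mask c1 c2 then nedge c1 else 0%N)).
    exact: iota_uniq.
  move=> l1; rewrite mem_iota => l1l; split; last first.
    move=> c /allpairsP [[c1 c2] /= [c1E _ ->]].
    by move: c1E; rewrite mem_codes; [move=> /and4P [_ _ _ /eqP]|lia].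
  apply: allpairs_uniq; [apply: IHn; lia|apply: IHn; lia|].
  by move=> [a b] [c d] _ _ [-> ->].
elim: k => [|k IHk]; rewrite codesE cat_uniq uN andbT; apply/andP; split.
- by case: (_ && _).
- apply/hasPn => _ /node_codesP [mask [c1 [c2 [? [? [-> _ _ _ _]]]]]].
  by case: (_ && _); rewrite // mem_seq1; apply/eqP.
- by rewrite map_inj_uniq // => ? ? [].
- apply/hasPn => _ /node_codesP [mask [c1 [c2 [? [? [-> _ _ _ _]]]]]].
  by apply/negP => /mapP [].
Qed.

Definition ncodes k x l := size (codes l k x l).

Lemma size_codes n k x l : (l <= n)%N -> size (codes n k x l) = ncodes k x l.
Proof.
move=> ln; apply: perm_size; apply: uniq_perm; try exact: uniq_codes.
by move=> c; rewrite !mem_codes.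
Qed.

Lemma ncodes_rec k x l : ncodes k x l =
  ((if k is k'.+1 then ncodes k' x l else (x == 0) && (l == 0))
   + \sum_(i < x.+1) 'C(i + k, i) * \sum_(x1 < (x - i).+1) \sum_(l1 < l - i)
       ncodes i x1 l1 * ncodes (i + k) (x - i - x1) (l - i.+1 - l1))%N.
Proof.
rewrite -(size_codes k x (leqnSn l)) codesE size_cat; congr (_ + _)%N.
  case: k => [|k]; first by case: andb.
  by rewrite size_map size_codes.
rewrite /node_codes size_flatten_iota; apply: eq_bigr => -[i /= ix] _.
rewrite size_flatten /shape -map_comp sumnE big_map.
rewrite (eq_bigr (fun=> \sum_(x1 < (x - i).+1) \sum_(l1 < l - i)
       ncodes i x1 l1 * ncodes (i + k) (x - i - x1) (l - i.+1 - l1))%N); last first.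
  move=> mask _ /=; rewrite (size_flatten_iota (x - i).+1).
  apply: eq_bigr => x1 _; rewrite size_flatten_iota; apply: eq_bigr => -[l1 /= l1l] _.
  rewrite size_allpairs !size_codes //; lia.
by rewrite big_const_seq count_predT size_masks iter_addn_0 mulnC.
Qed.

(** * Decoding into canonically labelled words *)

(** The common root is [0]. Shifting the labels of [c1] by [nvert c2] sends its root to [nvert c2],
    the label of the new child, and makes the labels coming from [c1] disjoint from those of [c2];
    together they fill an initial segment of [nat]. *)
Fixpoint decode (c : code) : word nat := match c with
  | CNil => [::]
  | CSep c => None :: decode c
  | CNode mask c1 c2 =>
    let H := wmap (addn (nvert c2)) (decode c1) in
    Some (Node (nvert c2) (chunk H)) :: weave (nvert c2) mask (unchunk H) (decode c2)
  end.

(** Being functional and increasing from parent to child, this relation certifies that the labels of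
    the decoded word form a tree rooted at [0]. *)
Fixpoint parent_rel (c : code) : rel nat := match c with
  | CNil => fun _ _ => false
  | CSep c => parent_rel c
  | CNode _ c1 c2 => fun d v => [|| parent_rel c2 d v, (d == nvert c2) && (v == 0)
      | [&& nvert c2 <= d, nvert c2 <= v & parent_rel c1 (d - nvert c2) (v - nvert c2)]]
  end.

Lemma parent_rel_lt c d v : parent_rel c d v -> v < d < nvert c.
Proof.
elim: c d v => //= mask c1 IH1 c2 IH2 d v; have := nvert_gt0 c1; have := nvert_gt0 c2.
by move=> n2 n1 /or3P [/IH2|/andP [/eqP -> /eqP ->]|/and3P [? ? /IH1]]; lia.
Qed.

Lemma parent_rel_fun c d v v' : parent_rel c d v -> parent_rel c d v' -> v = v'.
Proof.
elim: c d v v' => //= mask c1 IH1 c2 IH2 d v v'.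
move=> /or3P [p2|/andP [/eqP de /eqP ->]|/and3P [n2d n2v p1]];
  move=> /or3P [p2'|/andP [/eqP de' /eqP ->]|/and3P [n2d' n2v' p1']] //.
- exact: IH2 p2 p2'.
- by have := parent_rel_lt p2; lia.
- by have := parent_rel_lt p2; lia.
- by have := parent_rel_lt p2'; lia.
- by have := parent_rel_lt p1'; lia.
- by have := parent_rel_lt p2'; lia.
- by have := parent_rel_lt p1; lia.
- by have := IH1 _ _ _ p1 p1'; lia.
Qed.

Lemma decode_stats c : wf c ->
  count (@isep nat) (decode c) = nsep c /\ wedges (decode c) = nedge c.
Proof.
elim: c => //= [c IHc /IHc [-> E]|mask c1 IH1 c2 IH2]; first by split; rewrite // /wedges /= -/(wedges _) E.
move=> /and4P [/IH1 [n1 e1] /IH2 [n2 e2] /eqP n1m /eqP n2m].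
have [||-> E] := @weave_stats _ (nvert c2) mask
  (unchunk (wmap (addn (nvert c2)) (decode c1))) (decode c2) (starts_unchunk _).
- by rewrite count_unchunk count_isep_wmap n1.
- by rewrite n2.
split=> //; rewrite /wedges /= -!/(wedges _) E e2.
have := wedges_chunk (wmap (addn (nvert c2)) (decode c1)).
by rewrite wedges_wmap e1; lia.
Qed.

Lemma decode_ok c : wok (parent_rel c) 0 (decode c).
Proof.
elim: c => [//|//|mask c1 IH1 c2 IH2].
have [P PE] : exists P, P = parent_rel (CNode mask c1 c2) by eexists.
have Pn : P (nvert c2) 0 by rewrite PE /= !eqxx orbT.
have H : wok P (nvert c2) (wmap (addn (nvert c2)) (decode c1)).
  rewrite -[X in wok _ X]addn0; apply: wok_wmap IH1 => d v p1.
  by rewrite PE /= !leq_addr !addKn p1 !orbT.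
have {}IH2 : wok P 0 (decode c2).
  have sub d v : parent_rel c2 d v -> P d v by rewrite PE /= => ->.
  apply: sub_all IH2 => -[t|] //=; move: 0; elim/tree_ind_in: t => c g IHg v /=.
  move=> /andP [/sub -> gok] /=; apply/allP => t tg.
  by apply: IHg tg _ (allP gok t tg).
rewrite -PE /= Pn /=; move: H; rewrite wok_chunk => /andP [-> H] /=.
exact: weave_ok.
Qed.

Lemma decode_labels_lt c d : d \in wlabels (decode c) -> 0 < d < nvert c.
Proof. by move=> /(wok_labels (decode_ok c)) [e /parent_rel_lt]; lia. Qed.

Lemma decode_labels c d : wf c -> 0 < d < nvert c -> d \in wlabels (decode c).
Proof.
elim: c d => [d|c IHc d|mask c1 IH1 c2 IH2 d] /=; [by lia|exact: IHc|].
move=> /and4P [wf1 wf2 /eqP n1 /eqP n2] d0.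
rewrite wlabels_cons /= inE mem_cat.
have [//|dn2] := eqVneq d (nvert c2).
set H := wmap _ _; have : (d \in wlabels H) || (d \in wlabels (decode c2)).
  have [dn2'|dn2'] := ltnP d (nvert c2); first by rewrite IH2 ?orbT //; lia.
  rewrite /H wlabels_wmap; apply/orP; left; apply/mapP; exists (d - nvert c2); last by lia.
  apply: IH1 => //; lia.
rewrite wlabels_chunk -orbA /= => /orP [-> //|dHR].
rewrite (@weave_labels _ _ d mask (unchunk H)) ?orbT ?starts_unchunk //.
  by rewrite count_unchunk count_isep_wmap (decode_stats wf1).1.
by rewrite (decode_stats wf2).1.
Qed.

Lemma notop_labels (T : eqType) (c : T) (w : word T) : c \notin wlabels w -> notop c w.
Proof.
elim: w => // -[[d g]|] w IHw; rewrite wlabels_cons //= inE mem_cat !negb_or.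
by move=> /and3P [cd _ /IHw ->]; rewrite eq_sym cd.
Qed.

(** The root label [0] does not occur in the decoded word, so no agreement is claimed there. For
    [c1], whose root is shifted to [nvert c2], it is read off the head of the word. *)
Lemma decode_inj (T : eqType) (f g : nat -> T) c c' : wf c -> wf c' ->
    {in gtn (nvert c) &, injective f} -> {in gtn (nvert c') &, injective g} ->
    wmap f (decode c) = wmap g (decode c') ->
  c = c' /\ forall i, 0 < i < nvert c -> f i = g i.
Proof.
elim: c f g c' => [f g|c IHc f g|mask c1 IH1 c2 IH2 f g].
- by case=> //= _ _ _ _ _; split=> // i; lia.
- case=> //= c' wfc wfc' fI gI [/(IHc _ _ _ wfc wfc' fI gI) [-> E]]; split=> //.
case=> // mask' c1' c2' /= /and4P [wf1 wf2 /eqP n1 /eqP n2].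
move=> /and4P [wf1' wf2' /eqP n1' /eqP n2'] fI gI [fg Echunk].
rewrite !weave_wmap.
pose H := wmap (addn (nvert c2)) (decode c1).
pose H' := wmap (addn (nvert c2')) (decode c1').
rewrite -/H -/H' in Echunk *; rewrite fg.
have p1 := nvert_gt0 c1; have p1' := nvert_gt0 c1'.
have notopf : notop (f (nvert c2)) (wmap f (decode c2)).
  apply: notop_labels; rewrite wlabels_wmap; apply/mapP => -[d /decode_labels_lt dl].
  by move/(fI _ _ _ _); rewrite !inE => E; have := E ltac:(lia) ltac:(lia); lia.
have notopg : notop (g (nvert c2')) (wmap g (decode c2')).
  apply: notop_labels; rewrite wlabels_wmap; apply/mapP => -[d /decode_labels_lt dl].
  by move/(gI _ _ _ _); rewrite !inE => E; have := E ltac:(lia) ltac:(lia); lia.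
(* The head label is the same on both sides, so both words can be unwoven at [g (nvert c2')] and
   compared part by part. *)
rewrite fg in notopf => Eweave.
have Hf := @weaveK _ (g (nvert c2')) mask (wmap f (unchunk H)) _ _ notopf.
have Hg := @weaveK _ (g (nvert c2')) mask' (wmap g (unchunk H')) _ _ notopg.
have {Hf} [||| mE HE RE] := Hf.
- by rewrite starts_wmap starts_unchunk.
- by rewrite count_isep_wmap count_unchunk count_isep_wmap (decode_stats wf1).1.
- by rewrite count_isep_wmap (decode_stats wf2).1.
have {Hg} [||| mE' HE' RE'] := Hg.
- by rewrite starts_wmap starts_unchunk.
- by rewrite count_isep_wmap count_unchunk count_isep_wmap (decode_stats wf1').1.
- by rewrite count_isep_wmap (decode_stats wf2').1.
rewrite Eweave mE' in mE; rewrite Eweave HE' in HE; rewrite Eweave RE' in RE.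
have [||c2E fg2] := IH2 f g c2' wf2 wf2' _ _ (esym RE).
- by move=> i j; rewrite !inE => ? ?; apply: fI; rewrite inE; lia.
- by move=> i j; rewrite !inE => ? ?; apply: gI; rewrite inE; lia.
subst c2' mask'.
have EH : wmap f H = wmap g H'.
  rewrite -(chunkK (wmap f H)) -(chunkK (wmap g H')) (chunk_wmap f) (chunk_wmap g) Echunk.
  by rewrite (unchunk_wmap f) (unchunk_wmap g) HE.
rewrite /H /H' !wmap_comp in EH.
have [||c1E fg1] := IH1 _ _ c1' wf1 wf1' _ _ EH.
- by move=> i j; rewrite !inE => ? ? /fI; rewrite !inE => E; apply: (@addnI (nvert c2)); apply: E; lia.
- by move=> i j; rewrite !inE => ? ? /gI; rewrite !inE => E; apply: (@addnI (nvert c2)); apply: E; lia.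
subst c1'; split=> // i il.
have [?|i2] := ltnP i (nvert c2); first by apply: fg2; lia.
have [->//|in2] := eqVneq i (nvert c2).
by have := fg1 (i - nvert c2) ltac:(lia); rewrite /= subnKC.
Qed.

(** * Every word compatible with a parent function has a code *)

Section Surjectivity.
Variables (T : eqType) (p : T -> T) (r : T -> nat).
Hypothesis rp : forall x, r (p x) <= r x.
Let P : rel T := fun d v => (r v < r d) && (p d == v).

Definition below v d := exists n, iter n p d = v.

Lemma r_iter n x : r (iter n p x) <= r x.
Proof. by elim: n => // n IHn; rewrite iterS (leq_trans (rp _)). Qed.

Lemma tok_below v t : tok P v t -> {in tlabels t, forall d, below (troot t) d}.
Proof.
elim/tree_ind_in: t v => c g IHg v /= /andP [_ gok] d; rewrite inE.
case/predU1P => [->|/flatten_mapP [t tg dt]]; first by exists 0.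
have tok_t := allP gok t tg; have [n nE] := IHg t tg c tok_t d dt.
exists n.+1; rewrite iterS nE; case: t tok_t {tg dt nE} => e s /= /andP [/andP [_ /eqP //]].
Qed.

Lemma wok_below v w : wok P v w -> {in wlabels w, forall d, below v d}.
Proof.
move=> wokw d /flatten_mapP [[t|] // tw dt]; have tok_t := allP wokw _ tw.
have [n nE] := tok_below tok_t dt; exists n.+1; rewrite iterS nE.
by case: t tok_t {tw dt nE} => e s /= /andP [/andP [_ /eqP //]].
Qed.

(** The ancestor line of [d] passes through the top-level root above [d]. If it also met [c], then,
    both being children of [v] and of larger rank than [v], neither could be a proper ancestor of
    the other; they would coincide, against [notop]. *)
Lemma not_below v c w : P c v -> wok P v w -> notop c w ->
  {in v :: wlabels w, forall d, ~ below c d}.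
Proof.
move=> /andP [rcv /eqP pc] wokw nt.
have vc : ~ below c v by move=> [n nE]; have := r_iter n v; rewrite nE leqNgt rcv.
move=> d; rewrite inE => /predU1P [-> //|/flatten_mapP [[t|] // tw dt]] [n nE].
have tok_t := allP wokw _ tw; have /= ntc := allP nt _ tw.
have [m mE] := tok_below tok_t dt.
have pt : p (troot t) = v.
  by case: t tok_t {tw dt mE ntc} => e s /= /andP [/andP [_ /eqP //]].
have [mn|nm|mn] := ltngtP m n.
- apply: vc; exists (n - m.+1); rewrite -pt -mE -iterS -iterD -nE; congr (iter _ p d); lia.
- have : below v c; last move=> _.
    by exists 1.
  have rt : r v < r (troot t).
    by case: t tok_t {tw dt mE ntc pt} => e s /= /andP [/andP []].
  have : below (troot t) v.
    exists (m - n.+1); rewrite -mE -pc -nE -iterS -iterD; congr (iter _ p d); lia.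
  by move=> [k kE]; have := r_iter k v; rewrite kE leqNgt rt.
- by rewrite -mE mn nE eqxx in ntc.
Qed.

Lemma decode_surj v w : wok P v w -> exists c f,
  [/\ wf c, w = wmap f (decode c), f 0 = v, {in gtn (nvert c) &, injective f}
    & forall i, 0 < i < nvert c -> f i \in wlabels w].
Proof.
(* The number of separators may grow, but each new one replaces an edge, and edges are counted
   twice. *)
have [n] := ubnP (wedges w + count (@isep T) w + wedges w); elim: n v w => // n IHn v w.
case: w => [|[[c g]|] w] wn wokw.
- exists CNil, (fun=> v); split=> // [i j|i /=]; last by lia.
  by rewrite !inE /=; lia.
- have /andP [/andP [Pcv gok] wok_w] := wokw.
  pose H := map Some g ++ gather c w.
  have wokH : wok P c H.
    by rewrite /H /wok all_cat all_map -/(wok _ _ _) (wok_gather _ wok_w) andbT.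
  have wokR := wok_hole c wok_w.
  have st := @weave_stats _ c _ _ _ (starts_gather c w) (count_gather c w) (count_hole c w).
  rewrite unweaveK in st; have [st1 st2] := st.
  have hs : size (holes c w) = count id (holes c w) + count negb (holes c w).
    by rewrite -(count_predC id (holes c w)).
  have wsH : wedges H = sumn (map (@tedges T) g) + wedges (gather c w).
    by rewrite /H /wedges sumn_cat_map -map_comp.
  have wsw : wedges (Some (Node c g) :: w) = (sumn (map (@tedges T) g)).+1 + wedges w by [].
  have cH : count (@isep T) H = count id (holes c w).
    by rewrite /H count_cat isep_map_Some count_gather.
  have cR := count_hole c w.
  have [|c1 [f1 [wf1 HE f10 f1I f1l]]] := IHn c H _ wokH.
    by move: wn; rewrite wsw /= wsH cH; lia.
  have [|c2 [f2 [wf2 RE f20 f2I f2l]]] := IHn v (hole c w) _ wokR.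
    by move: wn; rewrite wsw /= cR; lia.
  (* The labels in [H] are below [c] and those in [hole c w] are not, so the two injections have
     disjoint images and can be glued. *)
  pose f i := if i < nvert c2 then f2 i else f1 (i - nvert c2).
  have f1E i : f (nvert c2 + i) = f1 i by rewrite /f ltnNge leq_addr addKn.
  have f2E i : i < nvert c2 -> f i = f2 i by rewrite /f => ->.
  have p1 := nvert_gt0 c1; have p2 := nvert_gt0 c2.
  have fn2 : f (nvert c2) = c by rewrite -[nvert c2]addn0 f1E.
  have HE' : H = wmap f (wmap (addn (nvert c2)) (decode c1)).
    by rewrite wmap_comp HE; apply: eq_in_wmap => i _ /=; rewrite f1E.
  have RE' : hole c w = wmap f (decode c2).
    by rewrite RE; apply: eq_in_wmap => i /decode_labels_lt il; rewrite f2E //; lia.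
  have f1b i : i < nvert c1 -> below c (f1 i).
    case: i => [|i] il; first by rewrite f10; exists 0.
    by apply: (wok_below wokH); apply: f1l; lia.
  have f2b i : i < nvert c2 -> ~ below c (f2 i).
    move=> il; apply: (not_below Pcv wokR (notop_hole c w)).
    case: i il => [|i] il; first by rewrite f20 mem_head.
    by rewrite inE f2l ?orbT //; lia.
  exists (CNode (holes c w) c1 c2), f; split.
  + rewrite /= wf1 wf2 /= -(decode_stats wf1).1 -(decode_stats wf2).1.
    by rewrite -(count_isep_wmap f1) -HE cH -(count_isep_wmap f2) -RE cR !eqxx.
  + rewrite /= fn2 weave_wmap fn2 -RE' -unchunk_wmap -HE' -chunk_wmap -HE'.
    by rewrite unchunk_cat ?starts_gather // chunk_cat ?starts_gather // unweaveK.
  + by rewrite f2E.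
  + move=> i j; rewrite !inE /= => il jl; rewrite /f.
    case: ltnP => i2; case: ltnP => j2.
    * by apply: f2I; rewrite inE.
    * by move=> E; case: (f2b _ i2); rewrite E; apply: f1b; lia.
    * by move=> E; case: (f2b _ j2); rewrite -E; apply: f1b; lia.
    * by move/f1I; rewrite !inE => E; have := E ltac:(lia) ltac:(lia); lia.
  + move=> i /= il.
    have sub : {subset wlabels (hole c w) <= wlabels w} /\ {subset wlabels (gather c w) <= wlabels w}.
      by split=> d dl; rewrite -(unweaveK c w) weave_labels ?starts_gather ?count_gather ?count_hole ?dl ?orbT.
    rewrite wlabels_cons mem_cat /= inE.
    rewrite /f; case: ltnP => i2; first by rewrite (sub.1 _ (f2l _ _)) ?orbT //; lia.
    have [->|i0] := eqVneq i (nvert c2); first by rewrite subnn f10 eqxx.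
    have : f1 (i - nvert c2) \in wlabels H by apply: f1l; lia.
    rewrite /H wlabels_cat mem_cat => /orP [|/(sub.2)->]; last by rewrite orbT.
    by rewrite /wlabels -map_comp => ->; rewrite orbT.
- have [|c [f [wfc wE f0 fI fl]]] := IHn v w _ wokw.
    by move: wn; rewrite /wedges /= -!/(wedges _); lia.
  by exists (CSep c), f; split=> //=; rewrite -wE.
Qed.

End Surjectivity.

(** * Tree walks as contours of labelled forests *)

Section WalkGraph.
Variable m : nat.
Implicit Types (v x y : 'I_m) (s : seq 'I_m).

Lemma walk_pairs_path (e : rel 'I_m) v s :
  all (fun pr => e pr.1 pr.2) (walk_pairs (v :: s)) = path e v (rcons s v).
Proof.
rewrite /walk_pairs rot1_cons.
have H y x : all (fun pr => e pr.1 pr.2) (zip (x :: s) (rcons s y)) = path e x (rcons s y).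
  by elim: s x => //= z s IHs x; rewrite IHs.
exact: H.
Qed.

Lemma walk_adj_sym s : symmetric (walk_adj s).
Proof. by move=> x y; apply: eq_has => pr; rewrite orbC. Qed.

Lemma walk_adjP s x y : walk_adj s x y ->
  (x, y) \in walk_pairs s \/ (y, x) \in walk_pairs s.
Proof.
move=> /hasP [[a b] ab /= /orP [/andP [/eqP <- /eqP <-]|/andP [/eqP <- /eqP <-]]];
  by [left|right].
Qed.

Lemma walk_adj_path v s : path (walk_adj (v :: s)) v (rcons s v).
Proof.
rewrite -walk_pairs_path; apply/allP => -[a b] ab; apply/hasP; exists (a, b) => //=.
by rewrite !eqxx.
Qed.

(** The walk itself connects the graph. On a cycle, both neighbours of a vertex of largest rank are
    its parent, hence equal, which three or more distinct vertices exclude. *)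
Lemma tree_walk_of_parent v s (Q : rel 'I_m) (rk : 'I_m -> nat) :
    (forall x y, Q x y -> rk y < rk x) ->
    (forall x y y', Q x y -> Q x y' -> y = y') ->
    path (fun x y => Q x y || Q y x) v (rcons s v) ->
    (forall x, x \in v :: s) ->
  is_tree_walk (v :: s).
Proof.
move=> Qrk Qfun; rewrite -walk_pairs_path => /allP Qs cov.
have adjQ x y : walk_adj (v :: s) x y -> Q x y || Q y x.
  by move=> /walk_adjP [/Qs|/Qs] //=; rewrite orbC.
apply/and4P; split.
- by apply/forallP.
- apply/allP => -[x y] /Qs /= Qxy; apply/eqP => xy; rewrite xy orbb in Qxy.
  by have := Qrk _ _ Qxy; rewrite ltnn.
- have cv x : connect (walk_adj (v :: s)) v x.
    apply: (path_connect (walk_adj_path v s)).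
    by have := cov x; rewrite !inE mem_rcons inE => ->; rewrite ?orbT.
  have csym := sym_connect_sym (walk_adj_sym (v :: s)).
  apply/forallP => x; apply/forallP => y.
  by apply: connect_trans (cv y); rewrite csym.
- apply/forallP => k; apply/forallP => -[c /= sc]; apply/negP => /and3P [k2 uc cc].
  have /hasP [x0 x0c _] : has predT c by case: c sc k2 {uc cc} => //= /eqP <-.
  case: (@arg_maxnP _ x0 (fun x => x \in c) rk x0c) => x xc xmax.
  case/rot_to: xc => i c' rc.
  have {}uc : uniq (x :: c') by rewrite -rc rot_uniq.
  have {}cc : cycle (walk_adj (v :: s)) (x :: c') by rewrite -rc rot_cycle.
  have {}sc : size (x :: c') = k by rewrite -rc size_rot (eqP sc).
  have {}xmax y : y \in x :: c' -> rk y <= rk x.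
    by rewrite -rc mem_rot; apply: xmax.
  have nQ y : y \in x :: c' -> walk_adj (v :: s) x y -> Q x y.
    by move=> /xmax yx /adjQ /orP [//|/Qrk]; rewrite ltnNge yx.
  case: c' {rc} uc cc sc xmax nQ => [|y c']; first by rewrite /= => *; lia.
  case/lastP: c' => [|c' z]; first by rewrite /= => *; lia.
  move=> /= /and3P [_ ync _] /andP [exy]; rewrite rcons_path last_rcons => /andP [_ ezx] _ _ nQ.
  have Qxy : Q x y by apply: nQ => //; rewrite !inE eqxx orbT.
  have Qxz : Q x z.
    by apply: nQ; rewrite 1?walk_adj_sym // !inE mem_rcons mem_head !orbT.
  by rewrite (Qfun _ _ _ Qxy Qxz) mem_rcons mem_head in ync.
Qed.

(* The parent of a vertex is the one visited just before its first visit. *)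
Lemma tree_walk_parent v s : is_tree_walk (v :: s) ->
  let r x := index x (v :: s) in let p x := nth v (v :: s) (r x).-1 in
  let P x y := (r y < r x) && (p x == y) in
  (forall x, r (p x) <= r x) /\
  path (fun x y => P x y || P y x) v (rcons s v).
Proof.
move=> /and4P [/forallP cov /allP loopfree _ /forallP acyc] r p P.
have r_nth i : r (nth v (v :: s) i) <= i.
  rewrite leqNgt; apply/negP => /(before_find v); rewrite /= eqxx //.
have rp x : r (p x) <= (r x).-1 by apply: r_nth.
split=> [x|]; first by apply: leq_trans (rp x) (leq_pred _).
have r_lt x : r x < size (v :: s) by rewrite index_mem.
have nth_r x : nth v (v :: s) (r x) = x by rewrite nth_index.
have r0 : r v = 0 by rewrite /r /= eqxx.
pose e x y := P x y || P y x.
have e_sym : symmetric e by move=> x y; rewrite /e orbC.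
have Pp x : 0 < r x -> P x (p x).
  by move=> x0; rewrite /P eqxx andbT (leq_ltn_trans (rp x)) // prednK.
have Padj x y : P x y -> walk_adj (v :: s) x y.
  move=> /andP [yx /eqP pxy]; rewrite walk_adj_sym; apply/hasP; exists (y, x); last first.
    by rewrite /= !eqxx.
  have := r_lt x; have := nth_r x; move: pxy yx; rewrite /p; case: (r x) => [|i] //=.
  move=> <- _ <- iN; rewrite /walk_pairs rot1_cons.
  apply/(nthP (v, v)); exists i; first by rewrite size_zip size_rcons /= minnn ltnW.
  by rewrite nth_zip ?size_rcons //= nth_rcons -ltnS iN.
have eadj x y : e x y -> walk_adj (v :: s) x y.
  by move=> /orP [/Padj//|/Padj]; rewrite walk_adj_sym.
have cv x : connect e x v.
  have [n] := ubnP (r x); elim: n x => // n IHn x xn.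
  have [x0|x0] := posnP (r x); first by rewrite -(nth_r x) x0 /=.
  apply: connect_trans (IHn (p x) _); last by have := rp x; lia.
  by apply: connect1; rewrite /e Pp.
rewrite -walk_pairs_path; apply/allP => -[x y] xy /=; rewrite -/(e x y).
(* The parent edges alone connect all vertices, so a step of the walk that is not a parent edge
   would close a simple path of parent edges into a cycle. *)
apply: contraT => nexy.
have xneqy : x != y by apply: (loopfree _ xy).
have : connect e x y.
  by apply: connect_trans (cv x) _; rewrite (sym_connect_sym e_sym).
case/connectP => q /shortenP [q' eq' uq' _] yE.
have kN : size (x :: q') < m.+1.
  by rewrite ltnS -(card_uniqP uq') (leq_trans (max_card _)) ?card_ord.
have /forallP/(_ (in_tuple (x :: q'))) := acyc (Ordinal kN).
case/negP; apply/and3P; split=> //.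
- rewrite [nat_of_ord _]/= /=; case: q' eq' yE {uq' kN} => [_ yx|z [|? ?] //=].
    by rewrite yx eqxx in xneqy.
  by rewrite andbT => exz yz; rewrite yz exz in nexy.
- rewrite /= rcons_path; apply/andP; split; first by apply: sub_path eq' => a b /eadj.
  by rewrite -yE walk_adj_sym; apply/hasP; exists (x, y); rewrite //= !eqxx.
Qed.

End WalkGraph.

(** * Contours of forests and their unique parsing *)

Section ForestWalk.
Variable T : eqType.
Implicit Types (v x y : T) (g : seq (tree T)) (w : word T).

Definition fwalk v g := flatten (map (twalk v) g).

Lemma fwalk_cons v c g g' :
  fwalk v (Node c g :: g') = c :: fwalk c g ++ v :: fwalk v g'.
Proof. by rewrite /fwalk /= -catA. Qed.

Lemma wwalk_Some v g : wwalk v (map Some g) = fwalk v g.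
Proof. by rewrite /wwalk -map_comp. Qed.

Lemma forest_of_word w : count (@isep T) w = 0 -> w = map Some (chunk w).
Proof.
rewrite -count_unchunk => u0; rewrite -{1}(chunkK w) (_ : unchunk w = [::]) ?cats0 //.
by case: (unchunk w) (starts_unchunk w) u0 => [|[]].
Qed.

Lemma last_fwalk x v g : last x (fwalk v g) = if g is [::] then x else v.
Proof.
elim: g x => [|[c g'] g IHg] x //; rewrite fwalk_cons /= last_cat /= IHg.
by case: g IHg.
Qed.

Lemma size_fwalk v g : size (fwalk v g) = (sumn (map (@tedges T) g)).*2.
Proof.
have H t u : size (twalk u t) = (tedges t).*2.
  elim/tree_ind_in: t u => c s IHs u /=; rewrite size_cat size_flatten /shape -map_comp /=.
  rewrite (_ : map _ s = map (fun t => (tedges t).*2) s); last first.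
    by apply/eq_in_map => t ts /=; apply: IHs.
  rewrite addn1 doubleS; congr _.+2; elim: s {IHs} => //= t s ->; lia.
rewrite /fwalk; elim: g => //= t g IHg; rewrite size_cat H IHg; lia.
Qed.

Lemma mem_fwalk v g x : x \in fwalk v g -> x \in v :: flatten (map (@tlabels T) g).
Proof.
have H t u : {subset twalk u t <= u :: tlabels t}.
  elim/tree_ind_in: t u => c s IHs u y /=; rewrite !inE mem_cat mem_seq1.
  case/or3P => [->|/flatten_mapP [t ts yt]|->]; rewrite ?orbT //.
  have := IHs t ts c y yt; rewrite inE => /orP [->|yl]; rewrite ?orbT //.
  by apply/orP; right; apply/orP; right; apply/flatten_mapP; exists t.
move=> /flatten_mapP [t tg /H]; rewrite !inE => /orP [->//|xt].
by apply/orP; right; apply/flatten_mapP; exists t.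
Qed.

Lemma flabels_fwalk v g : {subset flatten (map (@tlabels T) g) <= fwalk v g}.
Proof.
have H (t : tree T) u : {subset tlabels t <= twalk u t}.
  elim/tree_ind_in: t u => c s IHs u y /=; rewrite !inE => /orP [->//|].
  case/flatten_mapP => t ts yt; rewrite mem_cat; apply/orP; right; apply/orP; left.
  by apply/flatten_mapP; exists t => //; apply: IHs.
by move=> x /flatten_mapP [t tg /(H t v) xt]; apply/flatten_mapP; exists t.
Qed.

Lemma fwalk_path (P : rel T) v g : all (tok P v) g ->
  path (fun x y => P x y || P y x) v (fwalk v g).
Proof.
have H t u : tok P u t -> path (fun x y => P x y || P y x) u (twalk u t).
  elim/tree_ind_in: t u => c s IHs u /= /andP [Pcu sok].
  rewrite Pcu orbT cat_path /= andbT; apply/andP; split; last first.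
    by have := last_fwalk c c s; rewrite /fwalk => ->; case: s {IHs sok}; rewrite ?Pcu.
  elim: s IHs sok => //= t s IHs' IHs /andP [tok_t sok]; rewrite cat_path IHs ?mem_head //=.
  rewrite (_ : last c (twalk c t) = c); last by case: t {IHs tok_t} => d s'; rewrite /= last_cat.
  by apply: IHs' => // t' t's; apply: IHs; rewrite inE t's orbT.
rewrite /fwalk; elim: g => //= t g IHg /andP [/H tP /IHg gP]; rewrite cat_path tP.
by rewrite (_ : last v (twalk v t) = v) //; case: t {tP} => d s'; rewrite /= last_cat.
Qed.

(* A tree walk never turns back on an edge by entering a child labelled as the
   grandparent; this makes the parsing of [fwalk] unambiguous. *)
Fixpoint noback u v (t : tree T) := let: Node c g := t in (c != u) && all (noback v c) g.

Lemma tok_noback (P : rel T) (rk : T -> nat) u v t :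
    (forall x y, P x y -> rk y < rk x) -> rk u <= rk v -> tok P v t -> noback u v t.
Proof.
move=> Prk; elim/tree_ind_in: t u v => c g IHg u v uv /= /andP [/Prk vc gok].
apply/andP; split; first by apply/eqP => cu; rewrite cu in vc; lia.
by apply/allP => t tg; apply: IHg => //; [exact: ltnW|exact: (allP gok)].
Qed.

(** A nonempty remainder starts with the parent [u] of [v], which [noback] forbids as a child of
    [v]; so the next letter tells whether the forest at [v] continues. *)
Lemma fwalk_inj u v g g' s s' : all (noback u v) g -> all (noback u v) g' ->
    (if s is x :: _ then x == u else true) -> (if s' is x :: _ then x == u else true) ->
  fwalk v g ++ s = fwalk v g' ++ s' -> g = g' /\ s = s'.
Proof.
have [n] := ubnP (size (fwalk v g)); elim: n u v g g' s s' => // n IHn u v g g' s s'.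
case: g g' => [|[c h] g] [|[c' h'] g'] //.
- rewrite fwalk_cons; case: s => //= x s _ _ /andP [/andP [c'u _] _] xu _ [xc'].
  by rewrite xc' in xu; rewrite xu in c'u.
- rewrite fwalk_cons; case: s' => //= x s' _ /andP [/andP [cu _] _] _ _ xu [cx].
  by rewrite cx xu in cu.
rewrite !fwalk_cons /= size_cat /= => sn /andP [/andP [_ hb] gb] /andP [/andP [_ hb'] gb'] su su' [cc'].
rewrite -cc' -!catA !cat_cons in hb' *.
move=> /(IHn v c) [] //; rewrite ?eqxx //; first by lia.
by move=> <- [/(IHn u v) [] //]; [lia|move=> <- <-].
Qed.

End ForestWalk.

(** * Parsing a walk along parent edges *)

Section Parse.
Variables (T : eqType) (p : T -> T) (r : T -> nat).
Let P : rel T := fun d v => (r v < r d) && (p d == v).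
Let e : rel T := fun x y => P x y || P y x.

(** The forest at [v] ends when the walk steps to the parent of [v] or stops at [v]. The first
    alternative is a walk that stops inside an unfinished tree. *)
Lemma parse_walk v s : path e v s ->
  r v < r (last v s) \/ exists g s',
    [/\ s = fwalk v g ++ s', all (tok P v) g & if s' is x :: _ then P v x else true].
Proof.
have [n] := ubnP (size s); elim: n v s => // n IHn v [|y s] sn.
  by right; exists [::], [::].
move=> /= /andP [/orP [Pvy|Pyv] es]; first by right; exists [::], (y :: s).
have vy : r v < r y by case/andP: Pyv.
have [yl|[g [s' [sE gok s'P]]]] := IHn y s sn es.
  by left; apply: ltn_trans vy yl.
case: s' sE s'P => [|x s'] sE Pyx.
  by left; rewrite sE cats0 last_fwalk; case: (g).
have xv : x = v by case/andP: Pyx => _ /eqP <-; case/andP: Pyv => _ /eqP <-.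
subst x; have es' : path e v s' by move: es; rewrite sE cat_path /= => /and3P [].
have [|vl|[g' [s'' [s'E gok' s''P]]]] := IHn v s' _ es'.
- by move: sn; rewrite sE /= size_cat /=; lia.
- by left; rewrite sE last_cat.
right; exists (Node y g :: g'), s''; split=> //; last by rewrite /= Pyv gok.
by rewrite sE fwalk_cons s'E cat_cons -catA cat_cons.
Qed.

End Parse.

(** * Tree walks as pairs of a code and a permutation of the labels *)

Section Counting.
Variable m : nat.
Implicit Types (c : code) (sg : {perm 'I_m.+1}).

Definition relabel sg (i : nat) : 'I_m.+1 := sg (inord i).
(** The contour omits the initial root and ends with the return to it; [rotr 1] moves this last
    letter to the front, where a tree walk lists its root. *)
Definition code_walk c sg := rotr 1 (map (relabel sg) (wwalk 0 (decode c))).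

Lemma relabel_inj sg : {in gtn m.+1 &, injective (relabel sg)}.
Proof.
move=> i j; rewrite !inE => im jm /perm_inj /(congr1 val).
by rewrite /= !inordK.
Qed.

Definition perm_rank sg (x : 'I_m.+1) : nat := (sg^-1)%g x.
Definition perm_parent c sg : rel 'I_m.+1 :=
  fun x y => parent_rel c (perm_rank sg x) (perm_rank sg y).

Lemma perm_rankK sg i : i < m.+1 -> perm_rank sg (relabel sg i) = i.
Proof. by move=> im; rewrite /perm_rank permK inordK. Qed.

Section Code.
Variables (c : code) (sg : {perm 'I_m.+1}).
Hypotheses (wfc : wf c) (n0 : nsep c = 0) (nm : nvert c = m.+1).
Local Notation W := (wmap (relabel sg) (decode c)).
Local Notation v0 := (relabel sg 0).

Lemma decode_forest : W = map Some (chunk W).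
Proof. by apply: forest_of_word; rewrite count_isep_wmap (decode_stats wfc).1. Qed.

Lemma relabel_ok : wok (perm_parent c sg) v0 W.
Proof.
apply: wok_wmap (decode_ok c) => d v dv; have := parent_rel_lt dv.
by rewrite nm => ?; rewrite /perm_parent !perm_rankK //; lia.
Qed.

Lemma code_walkE : code_walk c sg = rotr 1 (fwalk v0 (chunk W)).
Proof. by rewrite /code_walk -wwalk_wmap {1}decode_forest wwalk_Some. Qed.

Lemma forest_ok : all (tok (perm_parent c sg) v0) (chunk W).
Proof. by move: relabel_ok; rewrite {1}decode_forest /wok all_map. Qed.

Lemma perm_parent_lt x y : perm_parent c sg x y -> perm_rank sg y < perm_rank sg x.
Proof. by move=> /parent_rel_lt /andP []. Qed.

Lemma forest_noback : all (noback v0 v0) (chunk W).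
Proof.
apply/allP => t /(allP forest_ok); apply: (@tok_noback _ _ (perm_rank sg)) => //.
exact: perm_parent_lt.
Qed.

Lemma size_code_walk : size (code_walk c sg) = (nedge c).*2.
Proof.
rewrite code_walkE size_rotr size_fwalk -(decode_stats wfc).2.
rewrite -(wedges_wmap (relabel sg)) {2}decode_forest /wedges -map_comp.
by [].
Qed.

Lemma code_walk_tree : is_tree_walk (code_walk c sg).
Proof.
rewrite code_walkE; set g := chunk W.
have cov : {subset flatten (map (@tlabels _) g) <= fwalk v0 g} by apply: flabels_fwalk.
have labE x : perm_rank sg x != 0 -> x \in fwalk v0 g.
  move=> x0; apply: cov; rewrite (_ : flatten _ = wlabels W); last first.
    by rewrite [in RHS]decode_forest /wlabels -map_comp.
  rewrite wlabels_wmap; apply/mapP; exists (perm_rank sg x).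
    by apply: decode_labels => //; rewrite nm lt0n x0 ltn_ord.
  by rewrite /relabel /perm_rank inord_val permKV.
have rank0 x : perm_rank sg x = 0 -> x = v0.
  move=> x0; rewrite -[x](permKV sg) /relabel; congr (sg _).
  by apply: val_inj; rewrite /= inordK.
have := last_fwalk v0 v0 g; have := fwalk_path forest_ok; rewrite -/g.
case/lastP: (fwalk v0 g) labE => [|q v] labE.
  (* An empty contour visits no label but the root, so only the walk of length [0] of size [1] is
     left. *)
  move=> _ _; rewrite /rotr /= eqSS; apply: contraT => m0.
  have := labE (relabel sg 1); rewrite perm_rankK ?in_nil ?ltnS ?lt0n //.
  by move/(_ isT).
rewrite last_rcons rotr1_rcons => Pq vv0.
have {}vv0 : v = v0 by case: (g) vv0.
subst v; apply: (tree_walk_of_parent (rk := perm_rank sg) _ _ Pq).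
- exact: perm_parent_lt.
- move=> x y y' Pxy /(parent_rel_fun Pxy) yy'.
  by apply: (@perm_inj _ (sg^-1)%g); apply: val_inj.
- move=> x; have [/rank0 ->|/labE] := eqVneq (perm_rank sg x) 0; first exact: mem_head.
  by rewrite mem_rcons.
Qed.

End Code.

Lemma code_walk_inj c c' sg sg' : wf c -> wf c' -> nsep c = 0 -> nsep c' = 0 ->
    nvert c = m.+1 -> nvert c' = m.+1 ->
  code_walk c sg = code_walk c' sg' -> (c, sg) = (c', sg').
Proof.
move=> wfc wfc' n0 n0' nm nm'; rewrite !code_walkE // => /(@rotr_inj 1) E.
set g := chunk _ in E; set g' := chunk _ in E.
have gg' : g = g'.
  have [v0E|v0E] := eqVneq (relabel sg 0) (relabel sg' 0).
    have gb := forest_noback sg wfc n0 nm; have gb' := forest_noback sg' wfc' n0' nm'.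
    rewrite v0E in gb E.
    by have [] := @fwalk_inj _ _ _ g g' [::] [::] gb gb' isT isT; rewrite ?E.
  (* A nonempty contour ends with its root, so distinct roots leave only two empty forests. *)
  have := last_fwalk (relabel sg 0) (relabel sg 0) g.
  rewrite E last_fwalk; case: (g') E => [|t' g''] E.
    by case: (g) E => // -[d s] g0; rewrite fwalk_cons.
  by case: (g) => [|t0 g0] /eqP; rewrite eq_sym (negbTE v0E).
have W : wmap (relabel sg) (decode c) = wmap (relabel sg') (decode c').
  by rewrite (decode_forest sg wfc n0) (decode_forest sg' wfc' n0') -/g -/g' gg'.
have := decode_inj wfc wfc' _ _ W; rewrite nm nm'.
case=> [||-> fE]; try exact: relabel_inj.
(* [decode_inj] gives agreement away from the root label only; two permutations that agree at all
   points but one are equal. *)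
congr (_, _); have E0 (x : 'I_m.+1) : x != ord0 -> sg x = sg' x.
  by move=> x0; have := fE x; rewrite /relabel inord_val lt0n x0 ltn_ord => ->.
apply/perm.permP => x; have [->|/E0 //] := eqVneq x ord0.
apply: (can_inj (permK sg^-1)); rewrite permK.
have [->|y0] := eqVneq ((sg^-1)%g (sg' ord0)) ord0; first by [].
by have := E0 _ y0; rewrite permKV => /perm_inj E1; rewrite -E1 eqxx in y0.
Qed.

Lemma code_walk_surj s : is_tree_walk s -> exists c sg,
  [/\ wf c, nsep c = 0, nvert c = m.+1, size s = (nedge c).*2 & s = code_walk c sg].
Proof.
case: s => [/= /eqP [m0]|v s ts].
  by exists CNil, 1%g; split=> //; rewrite /= m0.
have cov : forall x, x \in v :: s by case/and4P: ts => /forallP.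
pose r x := index x (v :: s); pose p x := nth v (v :: s) (r x).-1.
have [rp es] := tree_walk_parent ts; rewrite -/r -/p in rp es.
(* The walk returns to its start, which excludes an unfinished tree; the start has rank [0], hence
   no parent to step to, so the forest exhausts the walk. *)
have [|[g [s' [sE gok s'P]]]] := parse_walk es; first by rewrite last_rcons ltnn.
have {s'P} s'0 : s' = [::].
  case: s' s'P {sE} => // x s' /andP [].
  by rewrite (_ : index v (v :: s) = 0) //= eqxx.
rewrite s'0 cats0 in sE.
have wok_g : wok (fun d u => (r u < r d) && (p d == u)) v (map Some g).
  by rewrite /wok all_map.
have [c [f [wfc gE f0 fI fl]]] := decode_surj rp wok_g.
have [cs ce] := decode_stats wfc.
have n0 : nsep c = 0 by rewrite -cs -(count_isep_wmap f) -gE isep_map_Some.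
have decF := forest_of_word (etrans cs n0).
have walk_lt d : d \in wwalk 0 (decode c) -> d < nvert c.
  rewrite decF wwalk_Some => /mem_fwalk; rewrite inE => /predU1P [->|].
    exact: nvert_gt0.
  rewrite (_ : flatten _ = wlabels (decode c)) => [/decode_labels_lt/andP [] //|].
  by rewrite [in RHS]decF /wlabels -map_comp.
have sE' : rcons s v = map f (wwalk 0 (decode c)).
  by rewrite -wwalk_wmap -gE f0 wwalk_Some.
have nm : nvert c = m.+1.
  have := perm_size (uniq_perm (s1 := map f (iota 0 (nvert c))) _ (enum_uniq 'I_m.+1) _).
  rewrite size_map size_iota size_enum_ord; apply.
    rewrite map_inj_in_uniq ?iota_uniq // => i j; rewrite !mem_iota => il jl.
    exact: fI.
  move=> x; rewrite mem_enum; apply/mapP; have := cov x.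
  rewrite -mem_rcons sE' => /mapP [d /walk_lt dn ->]; exists d => //.
  by rewrite mem_iota.
have hI : injective (fun i : 'I_m.+1 => f i).
  by move=> i j /fI; rewrite !inE nm !ltn_ord => /(_ isT isT) /val_inj.
exists c, (perm hI); split=> //.
  transitivity (size (rcons s v)); first by rewrite size_rcons.
  rewrite sE size_fwalk -ce -(wedges_wmap f) -gE /wedges -map_comp.
  by [].
rewrite /code_walk -[LHS](rotr1_rcons) sE'; congr rotr.
by apply/eq_in_map => d /walk_lt dn; rewrite /relabel permE inordK -?nm.
Qed.

End Counting.

Lemma tree_walk_count x l : x <= l -> w (l.+1 - x) (2 * l) = ncodes 0 x l * (l.+1 - x)`!.
Proof.
move=> xl; rewrite subSn //; set m := l - x.
pose L := [seq code_walk c sg | c <- codes l 0 x l, sg <- enum {perm 'I_m.+1}].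
(* For a fixed number of edges, prescribing the excess amounts to prescribing the number of
   vertices. *)
have codesP c : (c \in codes l 0 x l)
    = [&& wf c, nsep c == 0, nvert c == m.+1 & nedge c == l].
  rewrite mem_codes //; congr [&& _, _ & _].
  by have := nvert_excess c; rewrite /m; lia.
have -> : w m.+1 (2 * l) = size L.
  rewrite /w cardE -(size_map val); apply/perm_size/uniq_perm.
  - by rewrite map_inj_uniq ?enum_uniq //; apply: val_inj.
  - apply: allpairs_uniq; rewrite ?uniq_codes ?enum_uniq // => -[c sg] [c' sg'].
    move=> /allpairsP [[d tg] /= [dL _ [-> ->]]] /allpairsP [[d' tg'] /= [dL' _ [-> ->]]].
    move: dL dL'; rewrite !codesP => /and4P [? /eqP ? /eqP ? _] /and4P [? /eqP ? /eqP ? _].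
    exact: code_walk_inj.
  move=> s; apply/mapP/allpairsP => [[t]|[[c sg] /= [+ _ ->]]].
    rewrite mem_enum inE => /code_walk_surj [c [sg [wfc n0 nm sz tE]]] ->.
    exists (c, sg); split; rewrite ?mem_enum //= codesP wfc n0 nm !eqxx /=.
    by move: sz; rewrite size_tuple; lia.
  rewrite codesP => /and4P [wfc /eqP n0 /eqP nm /eqP nl].
  have sz : size (code_walk c sg) == 2 * l by rewrite size_code_walk // nl mul2n.
  by exists (Tuple sz); rewrite // mem_enum inE /=; apply: code_walk_tree.
rewrite size_allpairs /ncodes; congr (_ * _).
by rewrite -cardE -card_Sn; apply: eq_card => sg; rewrite inE.
Qed.

Local Open Scope ring_scope.

(** * Formal power series *)

Record ps (A : Type) := Ps { cf : nat -> A }.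

HB.instance Definition _ (A : Type) := gen_eqMixin (ps A).
HB.instance Definition _ (A : Type) := gen_choiceMixin (ps A).

Lemma psP (A : Type) (a b : ps A) : (forall n, cf a n = cf b n) -> a = b.
Proof. by case: a b => [a] [b] /= ab; congr Ps; apply/funext. Qed.

Section PowerSeries.
Variable A : comNzRingType.
Implicit Types (a b c : ps A).

Definition ps0 : ps A := Ps (fun=> 0).
Definition psadd a b := Ps (fun n => cf a n + cf b n).
Definition psopp a := Ps (fun n => - cf a n).

Fact psaddA : associative psadd.
Proof. by move=> a b c; apply: psP => n /=; rewrite addrA. Qed.
Fact psaddC : commutative psadd.
Proof. by move=> a b; apply: psP => n /=; rewrite addrC. Qed.
Fact psadd0 : left_id ps0 psadd.
Proof. by move=> a; apply: psP => n /=; rewrite add0r. Qed.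
Fact psaddN : left_inverse ps0 psopp psadd.
Proof. by move=> a; apply: psP => n /=; rewrite addNr. Qed.

HB.instance Definition _ :=
  GRing.isZmodule.Build (ps A) psaddA psaddC psadd0 psaddN.

Definition psC (x : A) : ps A := Ps (fun n => if n is 0 then x else 0).
Definition psmul a b : ps A :=
  Ps (fun n => \sum_(i < n.+1) cf a i * cf b (n - i)%N).

Let tr N a : {poly A} := \poly_(i < N) cf a i.

(** A coefficient of a product sees only truncations of the factors; this brings commutativity and
    associativity over from polynomials. *)
Let cf_tr N n a b : (n < N)%N -> cf (psmul a b) n = (tr N a * tr N b)`_n.
Proof.
move=> nN; rewrite coefM /=; apply: eq_bigr => -[i /= iN] _.
by rewrite !coef_poly (leq_ltn_trans _ nN) // (leq_ltn_trans _ nN) ?leq_subr.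
Qed.

Fact psmulC : commutative psmul.
Proof. by move=> a b; apply: psP => n; rewrite !(cf_tr _ _ (ltnSn n)) mulrC. Qed.

Fact psmulA : associative psmul.
Proof.
have H a b c n : cf (psmul a (psmul b c)) n
    = (tr n.+1 a * (tr n.+1 b * tr n.+1 c))`_n.
  rewrite coefM [LHS]/=; apply: eq_bigr => -[i /= iN] _.
  by rewrite coef_poly iN -cf_tr // ltnS leq_subr.
move=> a b c; apply: psP => n; rewrite (psmulC (psmul a b)) !H; by rewrite mulrA mulrC.
Qed.

Fact psmul1 : left_id (psC 1) psmul.
Proof.
move=> a; apply: psP => n /=; rewrite big_ord_recl /= mul1r subn0.
by rewrite big1 ?addr0 // => i _; rewrite mul0r.
Qed.

Fact psmulD : left_distributive psmul psadd.
Proof.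
move=> a b c; apply: psP => n /=; rewrite -big_split.
by apply: eq_bigr => i _; rewrite mulrDl.
Qed.

Fact ps1_neq0 : psC 1 != 0.
Proof. by apply/eqP => /(congr1 (fun a => cf a 0)) /eqP; rewrite oner_eq0. Qed.

HB.instance Definition _ := GRing.Zmodule_isComNzRing.Build (ps A)
  psmulA psmulC psmul1 psmulD ps1_neq0.

Lemma cf0 n : cf (0 : ps A) n = 0. Proof. by []. Qed.
Lemma cfD a b n : cf (a + b) n = cf a n + cf b n. Proof. by []. Qed.
Lemma cfB a b n : cf (a - b) n = cf a n - cf b n. Proof. by []. Qed.
Lemma cf1 n : cf (1 : ps A) n = (n == 0)%:R. Proof. by case: n. Qed.
Lemma cfM a b n : cf (a * b) n = \sum_(i < n.+1) cf a i * cf b (n - i)%N.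
Proof. by []. Qed.

Lemma cf_sum I r (P : pred I) (F : I -> ps A) n :
  cf (\sum_(i <- r | P i) F i) n = \sum_(i <- r | P i) cf (F i) n.
Proof. by elim/big_rec2: _ => // i y z _ <-. Qed.

Lemma cfM0 a b : cf (a * b) 0 = cf a 0 * cf b 0.
Proof. by rewrite cfM big_ord_recl big_ord0 addr0. Qed.

Lemma cfCM x a n : cf (psC x * a) n = x * cf a n.
Proof.
rewrite cfM big_ord_recl /= subn0 big1 ?addr0 // => i _; exact: mul0r.
Qed.

Fact psC_is_zmod_morphism : zmod_morphism psC.
Proof. by move=> x y; apply: psP => -[|n] //=; rewrite subr0. Qed.
Fact psC_is_monoid_morphism : monoid_morphism psC.
Proof.
by split=> // x y; apply: psP => n; rewrite cfCM; case: n => //= n; rewrite mulr0.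
Qed.
HB.instance Definition _ :=
  GRing.isZmodMorphism.Build A (ps A) psC psC_is_zmod_morphism.
HB.instance Definition _ :=
  GRing.isMonoidMorphism.Build A (ps A) psC psC_is_monoid_morphism.

Definition psX : ps A := Ps (fun n => (n == 1)%:R).

Lemma cfXM0 a : cf (psX * a) 0 = 0.
Proof. by rewrite cfM0 mul0r. Qed.

Lemma cfXM a n : cf (psX * a) n.+1 = cf a n.
Proof.
rewrite cfM big_ord_recl /= mul0r add0r big_ord_recl /= mul1r subSS subn0.
by rewrite big1 ?addr0 // => i _; rewrite mul0r.
Qed.

(* [usum a] is the sum of [psX ^+ i * a i] over all [i]. *)
Definition usum (a : nat -> ps A) : ps A :=
  Ps (fun n => \sum_(i < n.+1) cf (a i) (n - i)%N).

Lemma cf_usum (a : nat -> ps A) n : cf (usum a) n = \sum_(i < n.+1) cf (a i) (n - i)%N.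
Proof. by []. Qed.

Lemma eq_usum (a b : nat -> ps A) : (forall i, a i = b i) -> usum a = usum b.
Proof. by move=> ab; congr usum; apply/funext. Qed.

Lemma usum_recl (a : nat -> ps A) : usum a = a 0 + psX * usum (fun i => a i.+1).
Proof.
apply: psP => -[|n]; rewrite cfD ?cfXM0 ?cfXM [LHS]big_ord_recl.
  by rewrite big_ord0.
by congr (_ + _); apply: eq_bigr => i _; rewrite subSS.
Qed.

Lemma mulr_usumr c (a : nat -> ps A) : c * usum a = usum (fun i => c * a i).
Proof.
apply: psP => n; elim: n a => [|n IHn] a.
  by rewrite usum_recl [in RHS]usum_recl mulrDr mulrCA !cfD !cfXM0.
by rewrite usum_recl [in RHS]usum_recl mulrDr mulrCA !cfD !cfXM IHn.
Qed.

Lemma usumB (a b : nat -> ps A) :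
  usum a - usum b = usum (fun i => a i - b i).
Proof. by apply: psP => n; rewrite cfB !cf_usum -sumrB. Qed.

End PowerSeries.

Section PowerSeriesMap.
Variables (A B : comNzRingType) (f : {rmorphism A -> B}).

Definition psmap (a : ps A) : ps B := Ps (fun n => f (cf a n)).

Fact psmap_is_zmod_morphism : zmod_morphism psmap.
Proof. by move=> a b; apply: psP => n /=; rewrite rmorphB. Qed.
Fact psmap_is_monoid_morphism : monoid_morphism psmap.
Proof.
split=> [|a b]; apply: psP => n.
  by case: n => [|n] /=; rewrite ?rmorph1 ?rmorph0.
by rewrite cfM /= rmorph_sum; apply: eq_bigr => i _; rewrite rmorphM.
Qed.
HB.instance Definition _ :=
  GRing.isZmodMorphism.Build (ps A) (ps B) psmap psmap_is_zmod_morphism.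
HB.instance Definition _ :=
  GRing.isMonoidMorphism.Build (ps A) (ps B) psmap psmap_is_monoid_morphism.

Lemma psmapX : psmap (psX A) = psX B.
Proof. by apply: psP => n /=; rewrite rmorph_nat. Qed.

Lemma psmapC x : psmap (psC x) = psC (f x).
Proof. by apply: psP => -[|n] //=; rewrite rmorph0. Qed.

Lemma psmap_usum (a : nat -> ps A) :
  psmap (usum a) = usum (fun i => psmap (a i)).
Proof. by apply: psP => n; rewrite cf_usum /= rmorph_sum. Qed.

End PowerSeriesMap.

Lemma fmulE f g : fmul f g = cf (Ps f * Ps g).
Proof. by []. Qed.
Lemma foneE : fone = cf 1.
Proof. by apply/funext => -[]. Qed.
Lemma fXE : fX = cf (psX rat).
Proof. by apply/funext => -[|[]]. Qed.
Lemma Ps_cf A (a : ps A) : Ps (cf a) = a. Proof. by case: a. Qed.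
Lemma fpowE f k : fpow f k = cf (Ps f ^+ k).
Proof.
elim: k => [|k IHk]; first by rewrite expr0 -foneE.
by rewrite /fpow iterS -/(fpow f k) IHk fmulE Ps_cf exprS.
Qed.

Lemma cf_exp_lt (A : comNzRingType) (h : ps A) k n :
  cf h 0 = 0 -> (n < k)%N -> cf (h ^+ k) n = 0.
Proof.
move=> h0; elim: k n => // k IHk n nk; rewrite exprS cfM big1 // => -[[|i] /= iN] _.
  by rewrite h0 mul0r.
by rewrite IHk ?mulr0 //; lia.
Qed.

Lemma fgeomE (h : ps rat) : cf h 0 = 0 -> (1 - h) * Ps (fgeom (cf h)) = 1.
Proof.
move=> h0; apply: psP => n.
(* [fgeom] cuts its sum at the index of the coefficient; the further powers of [h] vanish there, so
   one common cut at [n] serves all [m <= n]. *)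
have gE m : (m <= n)%N -> fgeom (cf h) m = cf (\sum_(k < n.+1) h ^+ k) m.
  move=> mn; rewrite cf_sum /fgeom (big_ord_widen n.+1 (fun k => fpow (cf h) k m)) //.
  rewrite [RHS](bigID (fun k : 'I_n.+1 => (k < m.+1)%N)) /= [X in _ = _ + X]big1 ?addr0.
    by apply: eq_bigr => k _; rewrite fpowE Ps_cf.
  by move=> k; rewrite -leqNgt => mk; rewrite cf_exp_lt.
have -> : cf ((1 - h) * Ps (fgeom (cf h))) n
        = cf ((1 - h) * \sum_(k < n.+1) h ^+ k) n.
  rewrite !cfM; apply: eq_bigr => i _; congr (_ * _); exact: gE (leq_subr _ _).
rewrite -opprB mulNr -subrX1 opprB cfB (cf_exp_lt h0) ?subr0 //.
Qed.

(** * The functional equations *)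

Section FixedPoint.
Variable A : comNzRingType.
Implicit Types (a b c d : ps A) (X Y : nat -> ps A).

Definition eqm n a b := forall i, (i < n)%N -> cf a i = cf b i.

Lemma eqmD n a b c d : eqm n a b -> eqm n c d -> eqm n (a + c) (b + d).
Proof. by move=> ab cd i iN; rewrite !cfD ab ?cd. Qed.

Lemma eqmM n a b c d : eqm n a b -> eqm n c d -> eqm n (a * c) (b * d).
Proof.
move=> ab cd i iN; rewrite !cfM; apply: eq_bigr => -[j /= ji] _.
by rewrite ab ?cd //; lia.
Qed.

Lemma eqmX n a b k : eqm n a b -> eqm n (a ^+ k) (b ^+ k).
Proof. by move=> ab; elim: k => // k IHk; rewrite !exprS; apply: eqmM. Qed.

Lemma eqm_psXM n a b : eqm n a b -> eqm n.+1 (psX A * a) (psX A * b).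
Proof. by move=> ab [|i] iN; rewrite ?cfXM0 // !cfXM ab. Qed.

Lemma eqm_usum n X Y :
  (forall k, eqm n (X k) (Y k)) -> eqm n (usum X) (usum Y).
Proof.
move=> XY i iN; rewrite !cf_usum; apply: eq_bigr => k _; apply: XY.
by apply: leq_ltn_trans iN; apply: leq_subr.
Qed.

Lemma eqm_sum n X Y k :
  (forall i, eqm n (X i) (Y i)) -> eqm n (\sum_(i < k) X i) (\sum_(i < k) Y i).
Proof. by move=> XY; elim/big_ind2: _ => // *; apply: eqmD. Qed.

(** The [n]-th coefficient of the solution is that of the iterate [n.+1] started at zero. Hence
    predicates on coefficients that hold for [0] and are preserved by [T] pass to the solution;
    signs and degrees are obtained in this way. Families are needed to solve for [V], [G] and all
    [beta k] at once. *)
Lemma contraction_fixpoint (T : (nat -> ps A) -> nat -> ps A) :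
    (forall n X Y, (forall k, eqm n (X k) (Y k)) ->
       forall k, eqm n.+1 (T X k) (T Y k)) ->
  exists X, (forall k, T X k = X k) /\
    forall J : nat -> nat -> A -> Prop, (forall k n, J k n 0) ->
      (forall Y, (forall k n, J k n (cf (Y k) n)) ->
         forall k n, J k n (cf (T Y k) n)) ->
      forall k n, J k n (cf (X k) n).
Proof.
move=> Tlip; pose it n := iter n T (fun=> 0).
have itD n m k : eqm n (it n k) (it (n + m)%N k).
  by elim: n k => // n IHn k; rewrite addSn /it !iterS; apply: Tlip.
pose X k := Ps (fun n => cf (it n.+1 k) n).
have Xit n k : eqm n (X k) (it n k).
  by move=> i iN; rewrite /= (itD i.+1 (n - i.+1)%N) // subnKC.
exists X; split=> [k|J J0 JT k n].
  apply: psP => n; rewrite (Tlip n _ _ (Xit n)) // (Xit n.+1) //.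
have Jit m : forall k n, J k n (cf (it m k) n).
  by elim: m => // m IHm; rewrite /it iterS; apply: JT.
exact: (Jit n.+1).
Qed.

End FixedPoint.

(** * Solving the system by iteration in [u] *)

Section System.
Variables (A : comNzRingType) (x q : A).
Local Notation xs := (psC x).
Local Notation qs := (psC q).
Local Notation u := (psX A).

(* [V] stands for the series [sum_n V_(n+1) u^n], so that the excess
   generating function is [C (1 + u V)]; moreover [G = 1 / (1 - x u V)]. *)
Definition system (V G : ps A) (beta : nat -> ps A) :=
  [/\ G = 1 + xs * u * V * G,
      V = qs * G * (xs ^+ 2 * u * V ^+ 2
            + usum (fun i => (xs * G ^+ 2) ^+ i.+2 * beta i.+2 ^+ 2)),
      beta 0 = 1
    & forall k, beta k.+1 = beta k + u * usum (fun i => 'C(i.+1 + k, i.+1)%:R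
          * (xs * G ^+ 2) ^+ i.+2 * beta i.+2 * beta (i + k).+2)].

Let TG (V G : ps A) := 1 + u * (xs * V * G).
Let Tb (G : ps A) (beta : nat -> ps A) (k : nat) :=
  1 + \sum_(j < k) u * usum (fun i => 'C(i.+1 + j, i.+1)%:R
          * (xs * G ^+ 2) ^+ i.+2 * beta i.+2 * beta (i + j).+2).
Let TV (V G : ps A) (beta : nat -> ps A) :=
  qs * G * (u * (xs ^+ 2 * V ^+ 2)
    + usum (fun i => (xs * G ^+ 2) ^+ i.+2 * beta i.+2 ^+ 2)).

Lemma system_solvable (JV JG Jb : nat -> A -> Prop) :
    (forall n, [/\ JV n 0, JG n 0 & Jb n 0]) ->
    (forall V G beta, (forall n, JV n (cf V n)) -> (forall n, JG n (cf G n)) ->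
       (forall k n, Jb n (cf (beta k) n)) ->
       [/\ forall n, JG n (cf (1 + u * (xs * V * G)) n),
           forall n, JV n (cf (qs * G * (u * (xs ^+ 2 * V ^+ 2)
    + usum (fun i => (xs * G ^+ 2) ^+ i.+2 * beta i.+2 ^+ 2))) n)
         & forall k n, Jb n (cf (1 + \sum_(j < k) u * usum (fun i =>
             'C(i.+1 + j, i.+1)%:R * (xs * G ^+ 2) ^+ i.+2
             * beta i.+2 * beta (i + j).+2)) n)]) ->
  exists V G beta, system V G beta /\
    [/\ forall n, JV n (cf V n), forall n, JG n (cf G n)
      & forall k n, Jb n (cf (beta k) n)].
Proof.
move=> J0 JT.
(* [X 0], [X 1], [X k.+2] stand for [V], [G], [beta k]. The equation for [V] contains [G] and the
   [beta k] without a factor [u]; inserting their updated values, which already agree to one order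
   more, makes [T] contracting. *)
pose T (X : nat -> ps A) k :=
  let G := TG (X 0) (X 1) in let beta := Tb (X 1) (fun k => X k.+2) in
  if k is k'.+1 then if k' is k''.+1 then beta k'' else G else TV (X 0) G beta.
have Tlip n X Y : (forall k, eqm n (X k) (Y k)) ->
    forall k, eqm n.+1 (T X k) (T Y k).
  move=> XY.
  have lG : eqm n.+1 (TG (X 0) (X 1)) (TG (Y 0) (Y 1)).
    apply: eqmD => //; apply: eqm_psXM; apply: eqmM => //; exact: eqmM.
  have lb k : eqm n.+1 (Tb (X 1) (fun k => X k.+2) k) (Tb (Y 1) (fun k => Y k.+2) k).
    apply: eqmD => //.
    pose F (Z : nat -> ps A) (j : nat) := u * usum (fun i => 'C(i.+1 + j, i.+1)%:R
          * (xs * Z 1 ^+ 2) ^+ i.+2 * Z i.+4 * Z (i + j).+4).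
    apply: (eqm_sum (X := F X) (Y := F Y)) => j.
    apply: eqm_psXM; apply: eqm_usum => i; apply: eqmM => //.
    apply: eqmM => //; apply: eqmM => //; apply: eqmX; apply: eqmM => //.
    exact: eqmX.
  case=> [|[|k]] //=; rewrite /TV; apply: eqmM; first exact: eqmM.
  apply: eqmD; first by apply: eqm_psXM; apply: eqmM => //; apply: eqmX.
  apply: eqm_usum => i; apply: eqmM; last exact: eqmX.
  by apply: eqmX; apply: eqmM => //; apply: eqmX.
have [X [TX JX]] := contraction_fixpoint Tlip.
have eG : X 1 = TG (X 0) (X 1) by rewrite -[LHS]TX.
have eb : (fun k => X k.+2) = Tb (X 1) (fun k => X k.+2).
  by apply/funext => k; rewrite -[LHS]TX.
have eV : X 0 = TV (X 0) (X 1) (fun k => X k.+2).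
  by rewrite eG eb -[LHS]TX.
exists (X 0), (X 1), (fun k => X k.+2); split.
  split.
  - by rewrite {1}eG /TG; ring.
  - by rewrite {1}eV /TV; congr (_ * (_ + _)); ring.
  - by rewrite -[LHS]/((fun k => X k.+2) 0%N) eb /Tb big_ord0 addr0.
  - move=> k; rewrite -[LHS]/((fun k => X k.+2) k.+1).
    by rewrite -[X k.+2]/((fun k => X k.+2) k) {1 2}eb /Tb big_ord_recr addrA.
pose J k n a := if k is k'.+1 then if k' is _.+1 then Jb n a else JG n a
                else JV n a.
have JXk : forall k n, J k n (cf (X k) n).
  apply: JX => [[|[|k]] n /=|Y JY]; try by case: (J0 n).
  have [jG jV jb] := JT (Y 0) (Y 1) (fun k => Y k.+2) (JY 0) (JY 1) (fun k => JY k.+2).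
  case=> [|[|k]] n; [|exact: jG|exact: jb].
  (* [V] is computed from the updated [G] and [beta], so the closure hypothesis is applied a second
     time, to these. *)
  by have [_ jV' _] := JT (Y 0) _ _ (JY 0) jG jb; apply: jV'.
split; [exact: (JXk 0)|exact: (JXk 1)|by move=> k; apply: (JXk k.+2)].
Qed.

End System.

(** * From the system to the walk recurrence *)

Section Verification.
Variables (A : comNzRingType) (z x q C : A).
Local Notation zs := (psC z).
Local Notation u := (psX A).
Hypotheses (xE : x = z * C ^+ 2) (CE : C = 1 + x) (qE : (1 - x) * q = 1).

Definition walk_recurrence (B : nat -> ps A) :=
  B 0 = 1 /\ forall k, B k.+1 = B k
    + usum (fun i => 'C(i + k, i)%:R * zs ^+ i.+1 * B i.+1 * B (i + k).+1).

Lemma system_walk_recurrence V G beta : system x q V G beta ->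
  exists2 B, walk_recurrence B & B 1%N = psC C * (1 + u * V).
Proof.
move=> [GE VE b0 bS].
have xsE : psC x = zs * psC C ^+ 2 by rewrite xE rmorphM rmorphXn.
have CsE : psC C = 1 + psC x by rewrite {1}CE rmorphD rmorph1.
have qsE : (1 - psC x) * psC q = 1.
  by rewrite -(rmorph1 (@psC A)) -rmorphB -rmorphM qE.
move: xsE CsE qsE VE bS; move: (psC x) (psC q) (psC C) GE => xs qs Cs GE xsE CsE qsE VE bS.
pose v := u * V; pose b1 := beta 1.
have b1E : b1 = 1 + u * usum (fun i => (xs * G ^+ 2) ^+ i.+2 * beta i.+2 ^+ 2).
  rewrite /b1 bS b0; congr (_ + _ * _); apply: eq_usum => i.
  by rewrite !addn0 binn mul1r -mulrA -expr2.
have G1 : G * (1 - xs * v) = 1 by rewrite /v mulrBr mulr1 {1}GE; ring.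
have vE : (1 - xs) * v = G * (xs ^+ 2 * v ^+ 2 + b1 - 1).
  rewrite {1}/v VE b1E.
  transitivity ((1 - xs) * qs * (G * (xs ^+ 2 * v ^+ 2 + u *
    usum (fun i => (xs * G ^+ 2) ^+ i.+2 * beta i.+2 ^+ 2)))); last first.
    by rewrite qsE; ring.
  by rewrite /v; ring.
(* For [B 1 = C G * beta 1] this is the required [B 1 = C (1 + u V)]. *)
have Gb1 : G * b1 = 1 + v.
  have H : (1 - xs) * v * (1 - xs * v) = xs ^+ 2 * v ^+ 2 + b1 - 1.
    rewrite vE; transitivity (G * (1 - xs * v) * (xs ^+ 2 * v ^+ 2 + b1 - 1)).
      by ring.
    by rewrite G1 mul1r.
  have -> : b1 = 1 - xs ^+ 2 * v ^+ 2 + (1 - xs) * v * (1 - xs * v) by rewrite H; ring.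
  transitivity (G * (1 - xs * v) * (1 + v)); first by ring.
  by rewrite G1 mul1r.
pose S := Cs * G; pose B k := S ^+ k * beta k.
have B1 : B 1%N = Cs * (1 + v) by rewrite /B expr1 /S -mulrA Gb1.
exists B => //; split=> [|k]; first by rewrite /B b0 mulr1.
(* This is why [S = C G] is the right scaling: multiplying by [S] absorbs the summand
   [z B_1 B_(k+1)] of the recurrence. *)
have S1 : S * (1 - zs * B 1%N) = 1.
  rewrite B1 /S; apply: etrans G1.
  transitivity (Cs * G - zs * Cs ^+ 2 * G * (1 + v)); first by ring.
  by rewrite -xsE CsE; ring.
pose X := u * usum (fun i => 'C(i.+1 + k, i.+1)%:R * zs ^+ i.+2 * B i.+2
                                * B (i.+1 + k).+1).
have BS : B k.+1 = S * (B k + X).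
  rewrite {1}/B bS exprS -mulrA; congr (_ * _); rewrite mulrDr; congr (_ + _).
  rewrite mulrCA /X; congr (_ * _); rewrite mulr_usumr; apply: eq_usum => i.
  rewrite /B xsE addSn.
  have -> : zs * Cs ^+ 2 * G ^+ 2 = zs * S ^+ 2 by rewrite /S; ring.
  have -> : S ^+ (i + k).+2 = S ^+ k * S ^+ i.+2 by rewrite -exprD; congr (_ ^+ _); lia.
  by rewrite exprMn_comm -?exprM ?mul2n -?addnn ?exprD; [ring|exact: mulrC].
rewrite usum_recl.
rewrite -/X add0n bin0 expr1 mul1r.
have : B k.+1 * (1 - zs * B 1%N) = B k + X.
  rewrite BS; transitivity (S * (1 - zs * B 1%N) * (B k + X)); first by ring.
  by rewrite S1 mul1r.
rewrite mulrBr mulr1 => BX.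
transitivity (B k + X + B k.+1 * (zs * B 1%N)); last by ring.
by rewrite -BX subrK.
Qed.

End Verification.

(** * Uniqueness for the walk recurrence *)

Section Uniqueness.
Variable A : comNzRingType.
Local Notation z := (psX A).

Definition zdiv n (a : ps (ps A)) := forall m l, (l < n)%N -> cf (cf a m) l = 0.

Lemma zdivD n a b : zdiv n a -> zdiv n b -> zdiv n (a + b).
Proof. by move=> an bn m l ln; rewrite !cfD an ?bn ?addr0. Qed.

Lemma zdivMr n a b : zdiv n a -> zdiv n (a * b).
Proof.
move=> an m l ln; rewrite cfM cf_sum big1 // => i _; rewrite cfM big1 // => j _.
by rewrite an ?mul0r //; apply: leq_ltn_trans ln; rewrite -ltnS.
Qed.

Lemma zdivMz n a : zdiv n a -> zdiv n.+1 (psC z * a).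
Proof. by move=> an m [|l] ln; rewrite cfCM ?cfXM0 // cfXM an. Qed.

Lemma zdiv_usum n (a : nat -> ps (ps A)) : (forall i, zdiv n (a i)) -> zdiv n (usum a).
Proof. by move=> an m l ln; rewrite cf_usum cf_sum big1 // => i _; apply: an. Qed.

(** All products carry at least one factor [z], so if the differences are divisible by [z^n] for all
    [k], induction on [k] gives divisibility by [z^(n+1)]. *)
Lemma walk_recurrence_unique B B' :
  walk_recurrence z B -> walk_recurrence z B' -> forall k, B k = B' k.
Proof.
move=> [B0 BS] [B'0 B'S].
have zd n : forall k, zdiv n (B k - B' k).
  elim: n => [|n IHn]; first by move=> k m l.
  elim=> [|k IHk]; first by rewrite B0 B'0 subrr => m l.
  rewrite BS B'S opprD addrACA usumB; apply: zdivD => //; apply: zdiv_usum => i.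
  rewrite (_ : _ - _ = psC z * ((B i.+1 - B' i.+1)
          * ('C(i + k, i)%:R * psC z ^+ i * B (i + k).+1)
        + (B (i + k).+1 - B' (i + k).+1)
          * ('C(i + k, i)%:R * psC z ^+ i * B' i.+1))); last by rewrite exprS; ring.
  by apply: zdivMz; apply: zdivD; apply: zdivMr.
move=> k; apply/eqP; rewrite -subr_eq0; apply/eqP.
by apply: psP => m; apply: psP => l; apply: (zd l.+1).
Qed.

End Uniqueness.

(** * Degrees, positivity and leading terms of the solution *)

Section Estimates.
Local Notation P := {poly {poly rat}}.
Local Notation xs := (psC ('X%:P : P)).
Local Notation qs := (psC ('X : P)).
Local Notation u := (psX P).
Implicit Types (a : ps P).

Definition m3 a n s d : rat := ((cf a n)`_s)`_d.

Lemma m3M a (b : ps P) n s d : m3 (a * b) n s d = \sum_(i < n.+1) \sum_(j < s.+1)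
  \sum_(k < d.+1) m3 a i j k * m3 b (n - i) (s - j) (d - k).
Proof.
rewrite /m3 cfM !coef_sum; apply: eq_bigr => i _; rewrite coefM coef_sum.
by apply: eq_bigr => j _; rewrite coefM.
Qed.

Lemma m3D a (b : ps P) n s d : m3 (a + b) n s d = m3 a n s d + m3 b n s d.
Proof. by rewrite /m3 cfD !coefD. Qed.

Lemma m3_usum (F : nat -> ps P) n s d :
  m3 (usum F) n s d = \sum_(i < n.+1) m3 (F i) (n - i) s d.
Proof. by rewrite /m3 cf_usum !coef_sum. Qed.

Lemma m3XM a n s d : m3 (u * a) n s d = if n is n'.+1 then m3 a n' s d else 0.
Proof. by rewrite /m3; case: n => [|n]; rewrite ?cfXM // cfXM0 !coef0. Qed.

Lemma m3C (p : P) n s d : m3 (psC p) n s d = if n is 0 then p`_s`_d else 0.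
Proof. by rewrite /m3; case: n => //= n; rewrite !coef0. Qed.

(** Here [n], [s], [d] are the exponents of [u], [q], [x]. With [n = xi - 1] and [K_(xi,s)] the
    coefficient of [q^(s+1)], the parameters [1 1 1] express the range of [s] and the bound
    [2 xi + s] on the degree. The bounds being linear, the parameters add up in products. *)
Definition bounded e b c (a : ps P) := forall n s d, 0 <= m3 a n s d /\
  (m3 a n s d != 0 -> [/\ e <= s, s <= b + n.*2 & d <= c + n.*2 + s]%N).

Lemma bounded0 e b c : bounded e b c 0.
Proof. by move=> n s d; rewrite /m3 cf0 !coef0 eqxx. Qed.

Lemma boundedW e b c e' b' c' a : (e' <= e)%N -> (b <= b')%N -> (c <= c')%N ->
  bounded e b c a -> bounded e' b' c' a.
Proof.
move=> ee bb cc ba n s d; have [a0 H] := ba n s d; split=> // /H [*]; split; lia.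
Qed.

Lemma boundedD e b c a a' :
  bounded e b c a -> bounded e b c a' -> bounded e b c (a + a').
Proof.
move=> ba ba' n s d; have [a0 H] := ba n s d; have [a0' H'] := ba' n s d.
rewrite m3D; split; first exact: addr_ge0.
have [->|/H//] := eqVneq (m3 a n s d) 0; rewrite add0r; exact: H'.
Qed.

Lemma psumr_neq0_ex n (F : 'I_n -> rat) : \sum_i F i != 0 -> exists i, F i != 0.
Proof.
move=> F0; apply/existsP; apply: contraNT F0 => /existsPn F0.
by rewrite big1 // => i _; apply/eqP; rewrite -[_ == _]negbK.
Qed.

Lemma boundedM e b c e' b' c' a a' : bounded e b c a -> bounded e' b' c' a' ->
  bounded (e + e') (b + b') (c + c') (a * a').
Proof.
move=> ba ba' n s d; rewrite m3M; split.
  do 3 (apply: sumr_ge0 => ? _); apply: mulr_ge0; [exact: (ba _ _ _).1|exact: (ba' _ _ _).1].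
move=> /psumr_neq0_ex [[i /= iN]] /psumr_neq0_ex [[j /= jN]] /psumr_neq0_ex [[k /= kN]].
rewrite mulf_eq0 negb_or => /andP [/(ba _ _ _).2 [? ? ?] /(ba' _ _ _).2 [? ? ?]].
split; lia.
Qed.

Lemma boundedX e b c a k : bounded e b c a -> bounded (k * e) (k * b) (k * c) (a ^+ k).
Proof.
move=> ba; elim: k => [|k IHk]; last by rewrite exprS !mulSn; apply: boundedM.
move=> n s d; rewrite expr0 -(rmorph1 (@psC P)) m3C.
case: n => [|n]; last by rewrite eqxx.
rewrite coef1; case: s => [|s] /=; last by rewrite coef0 eqxx.
by rewrite coef1; case: d => [|d].
Qed.

Lemma bounded1 b c : bounded 0 b c 1.
Proof. by apply: boundedW (boundedX 0 (bounded0 0 0 0)). Qed.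

Lemma bounded_nat b c k : bounded 0 b c k%:R.
Proof.
elim: k => [|k IHk]; last by rewrite mulrS; apply: boundedD => //; apply: bounded1.
exact: bounded0.
Qed.

Lemma bounded_u e b c a : bounded e b.+2 c.+2 a -> bounded e b c (u * a).
Proof.
move=> ba [|n] s d; rewrite m3XM ?eqxx //; have [a0 H] := ba n s d.
by split=> // /H [*]; split; lia.
Qed.

Lemma bounded_usum e b c (F : nat -> ps P) :
  (forall i, bounded e (b + i.*2) (c + i.*2) (F i)) -> bounded e b c (usum F).
Proof.
move=> bF n s d; rewrite m3_usum; split.
  by apply: sumr_ge0 => i _; apply: (bF _ _ _ _).1.
move=> /psumr_neq0_ex [[i /= iN]] /(bF _ _ _ _).2 [? ? ?]; split; lia.
Qed.

Lemma bounded_sum e b c (F : nat -> ps P) k :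
  (forall i, bounded e b c (F i)) -> bounded e b c (\sum_(i < k) F i).
Proof.
move=> bF; elim: k => [|k IHk]; first by rewrite big_ord0; apply: bounded0.
by rewrite big_ord_recr; apply: boundedD.
Qed.

Lemma bounded_x : bounded 0 0 1 xs.
Proof.
move=> n s d; rewrite m3C; case: n => [|n]; last by rewrite eqxx.
rewrite coefC; case: s => [|s] /=; last by rewrite coef0 eqxx.
by rewrite coefX; case: d => [|[|d]].
Qed.

(** A factor [q] permits one more power of [x], so the parameter [c] drops by one. *)
Lemma bounded_q e b c a : bounded e b c.+1 a -> bounded e.+1 b.+1 c (qs * a).
Proof.
move=> ba n s d; rewrite /m3 cfCM coefXM; case: s => [|s] /=.
  by rewrite coef0 eqxx.
by have [a0 H] := ba n s d; split=> // /H [*]; split; lia.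
Qed.

Lemma polynomial_system_solution : exists V G beta,
  system ('X%:P : P) 'X V G beta /\
  [/\ bounded 1 1 1 V, bounded 0 0 0 G & forall k, bounded 0 0 0 (beta k)].
Proof.
pose J e b c n (p : P) := forall s d, 0 <= p`_s`_d /\
  (p`_s`_d != 0 -> [/\ e <= s, s <= b + n.*2 & d <= c + n.*2 + s]%N).
have [n|V G beta bV bG bb|V [G [beta [sys [bV bG bb]]]]] :=
  @system_solvable P 'X%:P 'X (J 1 1 1)%N (J 0 0 0)%N (J 0 0 0)%N.
- by split=> s d; rewrite !coef0 eqxx.
- have {}bV : bounded 1 1 1 V by [].
  have {}bG : bounded 0 0 0 G by [].
  have {}bb k : bounded 0 0 0 (beta k) by apply: (bb k).
  have by_ i : bounded 0 0 i.+2 ((xs * G ^+ 2) ^+ i.+2).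
    apply: boundedW (boundedX i.+2 (boundedM bounded_x (boundedX 2 bG))); lia.
  split.
  + suff: bounded 0 0 0 (1 + u * (xs * V * G)) by [].
    apply: boundedD; [exact: bounded1|apply: bounded_u].
    by apply: boundedW (boundedM (boundedM bounded_x bV) bG).
  + suff: bounded 1 1 1 (qs * G * (u * (xs ^+ 2 * V ^+ 2)
      + usum (fun i => (xs * G ^+ 2) ^+ i.+2 * beta i.+2 ^+ 2))) by [].
    rewrite -mulrA; apply: bounded_q; apply: (boundedM bG (c' := 2)).
    apply: boundedD.
      apply: bounded_u; apply: boundedW (boundedM (boundedX 2 bounded_x) (boundedX 2 bV)) => //.
    apply: bounded_usum => i; apply: boundedW (boundedM (by_ i) (boundedX 2 (bb i.+2))); lia.
  + move=> k; pose F j := u * usum (fun i => 'C(i.+1 + j, i.+1)%:R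
       * (xs * G ^+ 2) ^+ i.+2 * beta i.+2 * beta (i + j).+2).
    suff: bounded 0 0 0 (1 + \sum_(j < k) F j) by [].
    apply: boundedD; first exact: bounded1.
    apply: bounded_sum => j.
    apply: bounded_u; apply: bounded_usum => i.
    apply: boundedW (boundedM (boundedM (boundedM (bounded_nat 0 0 _) (by_ i)) (bb _)) (bb _)); lia.
- by exists V, G, beta.
Qed.

End Estimates.

(** * Lower bounds for the coefficients of the solution *)

Section LowerBounds.
Local Notation P := {poly {poly rat}}.
Local Notation xs := (psC ('X%:P : P)).
Local Notation qs := (psC ('X : P)).
Local Notation u := (psX P).
Implicit Types (a b : ps P).

Definition nonneg a := forall n s d, 0 <= m3 a n s d.

Lemma bounded_nonneg e k c (a : ps P) : bounded e k c a -> nonneg a.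
Proof. by move=> ba n s d; apply: (ba _ _ _).1. Qed.

Lemma nonnegD a b : nonneg a -> nonneg b -> nonneg (a + b).
Proof. by move=> a0 b0 n s d; rewrite m3D addr_ge0. Qed.

Lemma nonnegM a b : nonneg a -> nonneg b -> nonneg (a * b).
Proof.
move=> a0 b0 n s d; rewrite m3M; do 3 (apply: sumr_ge0 => ? _).
exact: mulr_ge0.
Qed.

Lemma nonneg1 : nonneg 1.
Proof. exact: bounded_nonneg (bounded1 0 0). Qed.

Lemma nonnegX a k : nonneg a -> nonneg (a ^+ k).
Proof.
by move=> a0; elim: k => [|k IHk]; [apply: nonneg1|rewrite exprS; apply: nonnegM].
Qed.

Lemma nonneg_u : nonneg u.
Proof.
by move=> n s d; rewrite -[u]mulr1 m3XM; case: n => // n; apply: nonneg1.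
Qed.

Lemma nonneg_x : nonneg xs. Proof. exact: bounded_nonneg bounded_x. Qed.

Lemma nonneg_q : nonneg qs.
Proof. by rewrite -[qs]mulr1; apply: bounded_nonneg (bounded_q (bounded1 0 1)). Qed.

Lemma nonneg_usum (F : nat -> ps P) : (forall i, nonneg (F i)) -> nonneg (usum F).
Proof. by move=> F0 n s d; rewrite m3_usum; apply: sumr_ge0 => i _; apply: F0. Qed.

Lemma nonneg_nat k : nonneg k%:R. Proof. exact: bounded_nonneg (bounded_nat 0 0 k). Qed.

(** Coefficientwise comparison. It serves to show that the upper bounds on the degrees of the
    [K_(xi,s)] are attained. *)
Definition dom a b := nonneg (b - a).

Lemma dom_refl a : dom a a.
Proof. by move=> n s d; rewrite subrr /m3 cf0 !coef0. Qed.

Lemma dom_trans b a c : dom a b -> dom b c -> dom a c.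
Proof. by move=> ab bc; rewrite /dom -(subrK b c) -addrA; apply: nonnegD. Qed.

Lemma domM a b c d : nonneg b -> nonneg c -> dom a b -> dom c d -> dom (a * c) (b * d).
Proof.
move=> b0 c0 ab cd; rewrite /dom.
rewrite (_ : _ - _ = b * (d - c) + (b - a) * c); last by ring.
by apply: nonnegD; apply: nonnegM.
Qed.

Lemma dom_coef a b n s d : dom a b -> m3 a n s d <= m3 b n s d.
Proof.
by move=> /(_ n s d); rewrite /m3 cfB !coefB subr_ge0.
Qed.

Lemma domMr1 a b c : nonneg b -> dom a b -> dom 1 c -> dom a (b * c).
Proof.
by move=> ? ? ?; rewrite -[a]mulr1; apply: domM => //; apply: nonneg1.
Qed.

Section System.
Variables (V G : ps P) (beta : nat -> ps P).
Hypotheses (sys : system ('X%:P : P) 'X V G beta) (bV : bounded 1 1 1 V)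
  (bG : bounded 0 0 0 G) (bb : forall k, bounded 0 0 0 (beta k)).

Let V0 : nonneg V := bounded_nonneg bV.
Let G0 : nonneg G := bounded_nonneg bG.
Let b0 k : nonneg (beta k) := bounded_nonneg (bb k).
Let xV0 : nonneg (xs * u * V).
Proof. by apply: nonnegM => //; apply: nonnegM; [apply: nonneg_x|apply: nonneg_u]. Qed.

Let G_ge1 : dom 1 G.
Proof.
case: sys => GE _ _ _; rewrite /dom {1}GE addrAC subrr add0r.
exact: nonnegM.
Qed.

Let G_ge_xV : dom (xs * u * V) G.
Proof.
case: sys => GE _ _ _; rewrite /dom {1}GE.
rewrite (_ : _ - _ = 1 + xs * u * V * (G - 1)); last by ring.
by apply: nonnegD; [apply: nonneg1|apply: nonnegM].
Qed.

Let y0 i : nonneg ((xs * G ^+ 2) ^+ i).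
Proof. by apply/nonnegX/nonnegM; [apply: nonneg_x|apply: nonnegX]. Qed.

Let y2_ge : dom (xs ^+ 2) ((xs * G ^+ 2) ^+ 2).
Proof.
have xG : dom xs (xs * G ^+ 2).
  apply: domMr1; [exact: nonneg_x|exact: dom_refl|].
  by rewrite expr2; apply: domMr1.
by rewrite !expr2; apply: domM => //; [apply: (y0 1)|apply: nonneg_x].
Qed.

Let beta_step0 k : nonneg (usum (fun i => 'C(i.+1 + k, i.+1)%:R
   * (xs * G ^+ 2) ^+ i.+2 * beta i.+2 * beta (i + k).+2)).
Proof.
apply: nonneg_usum => i; apply: nonnegM => //; apply: nonnegM => //.
by apply: nonnegM; [apply: nonneg_nat|].
Qed.

Let beta_ge1 k : dom 1 (beta k).
Proof.
case: sys => _ _ be0 bS; elim: k => [|k IHk]; first by rewrite be0; apply: dom_refl.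
apply: dom_trans IHk _; rewrite /dom bS addrAC subrr add0r.
by apply: nonnegM; [apply: nonneg_u|apply: beta_step0].
Qed.

Let ux0 : nonneg (u * xs ^+ 2).
Proof. by apply: nonnegM; [apply: nonneg_u|apply/nonnegX/nonneg_x]. Qed.

(** The summand [i = 0] in the equation for [beta 2] dominates [u * xs ^+ 2 * beta 2], which can be
    iterated. Its binomial coefficient is [2]; one copy suffices. *)
Let beta2_ge n : dom ((u * xs ^+ 2) ^+ n) (beta 2).
Proof.
elim: n => [|n IHn]; first exact: beta_ge1.
case: sys => _ _ _ bS; rewrite bS exprS usum_recl.
apply: (@dom_trans (u * xs ^+ 2 * beta 2)).
  by apply: domM => //; [apply: nonnegX|apply: dom_refl].
apply: (@dom_trans (u * ((xs * G ^+ 2) ^+ 2 * beta 2 * beta 3))); rewrite /dom.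
  rewrite (_ : _ - _ = u * ((xs * G ^+ 2) ^+ 2 * beta 2 * beta 3
    - xs ^+ 2 * beta 2)); last by ring.
  apply: nonnegM; first exact: nonneg_u.
  apply: domMr1 => //; first exact: nonnegM.
  apply: domM => //; exact: dom_refl.
set Z := usum _; rewrite (_ : 'C(_, _) = 2%N) // addn1.
rewrite (_ : _ - _ = beta 1 + u * ((xs * G ^+ 2) ^+ 2 * beta 2 * beta 3)
   + u * (u * Z)); last by ring.
have Z0 : nonneg Z.
  apply: nonneg_usum => i; apply: nonnegM => //; apply: nonnegM => //.
  by apply: nonnegM; [apply: nonneg_nat|].
apply: nonnegD; first apply: nonnegD => //; apply: nonnegM; try exact: nonneg_u.
  by apply: nonnegM => //; apply: nonnegM.
by apply: nonnegM => //; apply: nonneg_u.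
Qed.

Let x2_0 : nonneg (xs ^+ 2). Proof. exact/nonnegX/nonneg_x. Qed.

Let V_ge : dom (qs * G * ((xs * G ^+ 2) ^+ 2 * beta 2 ^+ 2)) V.
Proof.
case: sys => _ VE _ _; rewrite /dom {1}VE usum_recl -mulrBr.
apply: nonnegM; first by apply: nonnegM => //; apply: nonneg_q.
set Z := usum _; rewrite (_ : _ - _ = xs * u * V * (xs * V) + u * Z); last by ring.
apply: nonnegD; last apply: nonnegM; try exact: nonneg_u.
  by apply: nonnegM => //; apply: nonnegM => //; apply: nonneg_x.
by apply: nonneg_usum => i; apply: nonnegM => //; apply: nonnegX.
Qed.

(** This exhibits the top power [x^(2n+2)] in the coefficient of [u^n q], that is, in [K_(xi,0)] for
    [xi = n + 1]. *)
Lemma dom_system_power n : dom (qs * (xs ^+ 2 * (u * xs ^+ 2) ^+ n)) V.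
Proof.
apply: dom_trans V_ge; rewrite -mulrA.
apply: domM; [exact: nonneg_q|apply: nonnegM => //; exact: nonnegX|exact: dom_refl|].
rewrite -[X in dom X _]mul1r; apply: domM => //.
  by apply: nonnegM => //; apply: nonnegX.
apply: domM => //; first exact: nonnegX.
by rewrite expr2; apply: domMr1.
Qed.

(** The factor [G] in the equation for [V] dominates [x u V]. One more [u] and one more [q] come
    with three more powers of [x], exactly as the extremal degree grows. *)
Lemma dom_system_shift : dom (qs * xs ^+ 3 * (u * V)) V.
Proof.
apply: dom_trans V_ge.
rewrite (_ : qs * _ * _ = qs * (xs * u * V) * (xs ^+ 2)); last by ring.
apply: domM => //; first by apply: nonnegM => //; apply: nonneg_q.
  apply: domM => //; [exact: nonneg_q|exact: dom_refl].
by apply: domMr1 => //; rewrite expr2; apply: domMr1.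
Qed.

End System.
End LowerBounds.

(** * The two highest coefficients in [q] *)

Section TopCoefficients.
Variable A : comNzRingType.
Implicit Types (p r : {poly A}) (a : ps {poly A}) (t : ps A).

Lemma coefM_top p r i j : (size p <= i.+1)%N -> (size r <= j.+1)%N ->
  (p * r)`_(i + j) = p`_i * r`_j.
Proof.
move=> pi rj; have iN : (i < (i + j).+1)%N by lia.
rewrite coefM (bigD1 (Ordinal iN)) //= addKn big1 ?addr0 // => -[k /= kN] /eqP ki.
have [ik|ki'] := ltnP i k.
  by rewrite nth_default ?mul0r // (leq_trans pi).
rewrite [r`__]nth_default ?mulr0 //; apply: leq_trans rj _.
by have : k != i by [apply/eqP => ki2; apply: ki; apply/val_inj]; lia.
Qed.

(** Multiplication by ['X] turns the coefficient just below the top into one of the same index, with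
    value [0] when there is none, and avoids truncated subtraction. *)
Lemma coefM_subtop p r i j : (size p <= i.+1)%N -> (size r <= j.+1)%N ->
  ('X * (p * r))`_(i + j) = p`_i * ('X * r)`_j + ('X * p)`_i * r`_j.
Proof.
move=> pi rj; rewrite mulrCA.
have pE : p = take_poly i p + (p`_i)%:P * 'X^i.
  rewrite -{1}(poly_take_drop i p); congr (_ + _ * _).
  rewrite [LHS]size1_polyC ?coef_drop_poly ?add0n // size_drop_poly; lia.
rewrite {1}pE mulrDl coefD -mulrA coefCM coefXnM ltnNge leq_addr /= addKn addrC.
congr (_ + _).
case: i pi {pE} => [|i] pi; first by rewrite take_poly0l mul0r coef0 coefXM /= mul0r.
rewrite addSnnS coefM_top ?size_take_poly //; last first.
  by rewrite (leq_trans (size_polyMleq _ _)) // size_polyX.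
by rewrite coef_take_poly ltnSn !coefXM.
Qed.

(* [a] has degree at most [b + 2 n] in its [n]-th coefficient, and [t], [s]
   collect the coefficients of degree [b + 2 n] and [b + 2 n - 1]. *)
Definition leading b a t s := forall n,
  [/\ (size (cf a n) <= (b + n.*2).+1)%N, (cf a n)`_(b + n.*2) = cf t n
    & ('X * cf a n)`_(b + n.*2) = cf s n].

Lemma leading_inj b a t s t' s' :
  leading b a t s -> leading b a t' s' -> t = t' /\ s = s'.
Proof.
move=> l l'; split; apply: psP => n; case: (l n) (l' n) => _ t1 s1 [_ t2 s2].
  by rewrite -t1 -t2.
by rewrite -s1 -s2.
Qed.

Lemma leadingD b a t s a' t' s' :
  leading b a t s -> leading b a' t' s' -> leading b (a + a') (t + t') (s + s').
Proof.
move=> l l' n; case: (l n) (l' n) => [s1 t1 u1] [s2 t2 u2].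
rewrite !cfD mulrDr !coefD t1 t2 u1 u2; split=> //.
by rewrite (leq_trans (size_polyD _ _)) // geq_max s1.
Qed.

Lemma leadingM b a t s b' a' t' s' : leading b a t s -> leading b' a' t' s' ->
  leading (b + b') (a * a') (t * t') (t * s' + s * t').
Proof.
move=> l l' n.
have E (i : 'I_n.+1) : (b + b' + n.*2 = (b + i.*2) + (b' + (n - i).*2))%N.
  by case: i => i /= iN; lia.
rewrite cfD !cfM mulr_sumr !coef_sum -big_split; split.
- apply: (leq_trans (size_sum _ _ _)); apply/bigmax_leqP => i _.
  case: (l i) (l' (n - i)%N) => [s1 _ _] [s2 _ _].
  rewrite (E i) (leq_trans (size_polyMleq _ _)) //.
  by move: (size _) (size _) s1 s2 => m1 m2 s1 s2; lia.
- apply: eq_bigr => i _; case: (l i) (l' (n - i)%N) => [s1 t1 _] [s2 t2 _].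
  by rewrite (E i) coefM_top // t1 t2.
- apply: eq_bigr => i _; case: (l i) (l' (n - i)%N) => [s1 t1 u1] [s2 t2 u2].
  by rewrite (E i) coefM_subtop // t1 t2 u1 u2.
Qed.

(** The degree bound grows by two per power of [u], so a factor [u] lowers the base by two. *)
Lemma leading_u b a t s : leading b.+2 a t s ->
  leading b (psX _ * a) (psX A * t) (psX A * s).
Proof.
move=> l [|n]; first by rewrite !cfXM0 mulr0 !coef0 size_poly0.
by rewrite !cfXM doubleS !addnS -!addSn; apply: l.
Qed.

Lemma leadingS b a t s : leading b a t s -> leading b.+1 a 0 t.
Proof.
move=> l n; case: (l n) => s1 t1 _; rewrite addSn coefXM /= t1.
by rewrite nth_default ?(leq_trans s1).
Qed.

Lemma leadingC c : leading 0 (psC c%:P) (psC c) 0.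
Proof.
case=> [|n]; rewrite /= ?mulr0 ?coef0 ?size_poly0 // coefC coefXM.
by rewrite (leq_trans (size_polyC_leq1 _)).
Qed.

Lemma leadingX : leading 1 (psC 'X) 1 0.
Proof.
case=> [|n]; rewrite /= ?mulr0 ?coef0 ?size_poly0 // size_polyX coefX coefXM coefX.
by [].
Qed.

Lemma leading_ex b a : (forall n, size (cf a n) <= (b + n.*2).+1)%N ->
  exists t s, leading b a t s.
Proof.
by exists (Ps (fun n => (cf a n)`_(b + n.*2))),
  (Ps (fun n => ('X * cf a n)`_(b + n.*2))) => n.
Qed.

End TopCoefficients.

Section SystemTop.
Local Notation P := {poly {poly rat}}.
Local Notation xs := (psC ('X%:P : P)).
Local Notation qs := (psC ('X : P)).
Local Notation X := (psC ('X : {poly rat})).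
Local Notation u := (psX {poly rat}).
Variables (V G : ps P) (beta : nat -> ps P).
Hypotheses (sys : system ('X%:P : P) 'X V G beta) (bV : bounded 1 1 1 V)
  (bG : bounded 0 0 0 G) (bb : forall k, bounded 0 0 0 (beta k)).

Lemma bounded_size e b c a n : bounded e b c a -> (size (cf a n) <= (b + n.*2).+1)%N.
Proof.
move=> ba; apply/leq_sizeP => s ls; apply/polyP => d; rewrite coef0; apply/eqP.
by apply: contraLR ls => /(ba n s d).2 [_ + _]; rewrite -ltnNge.
Qed.

Let lead1 : leading 0 (1 : ps P) 1 0.
Proof. by have := leadingC (1 : {poly rat}); rewrite !rmorph1. Qed.

Let leading_uM a t s : leading 0 a t s -> leading 0 (psX P * a) 0 0.
Proof. by move=> /leadingS/leadingS/leading_u; rewrite mulr0. Qed.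

Let bounded_y i : bounded 0 0 i.+2 ((xs * G ^+ 2) ^+ i.+2).
Proof. apply: boundedW (boundedX i.+2 (boundedM bounded_x (boundedX 2 bG))); lia. Qed.

(** The corrections to [1] carry a factor [u] without the two powers of [q] allowed for it, so they
    stay below both leading orders. *)
Lemma leading_beta k : leading 0 (beta k) 1 0.
Proof.
case: sys => _ _ b0 bS; elim: k => [|k IHk]; first by rewrite b0.
rewrite bS -[X in leading _ _ X _]addr0 -[X in leading _ _ _ X]addr0.
apply: leadingD => //; set Z := usum _.
have [t [s lZ]] : exists t s, leading 0 Z t s.
  apply: leading_ex => n; apply: (@bounded_size 0 0 2); apply: bounded_usum => i.
  apply: boundedW (boundedM (boundedM (boundedM (bounded_nat 0 0 _)
    (bounded_y i)) (bb _)) (bb _)); lia.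
exact: leading_uM lZ.
Qed.

Lemma leading_system T S : leading 1 V T S ->
  T = X ^+ 2 * (1 + u * T ^+ 2) /\
  S = X * u * T ^+ 2 + 4%:R * X ^+ 3 * u * T + 2%:R * u * X ^+ 2 * T * S.
Proof.
move=> lV; case: (sys) => GE VE _ _.
have lx : leading 0 xs X 0 := leadingC _.
have [g [h lG]] : exists g h, leading 0 G g h.
  by apply: leading_ex => n; apply: bounded_size bG.
have [gE hE] : g = 1 /\ h = u * X * T.
  (* [x V G] has base [1]; it is raised to [2] to pay for the factor [u], so [G - 1] contributes to
     the second order only. *)
  have := leadingD lead1 (leading_u (leadingS (leadingM (leadingM lx lV) lG))).
  rewrite -[1 + _](_ : G = _); last by rewrite {1}GE; ring.
  move=> /(leading_inj lG) [gE hE].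
  have {}gE : g = 1 by rewrite gE mulr0 addr0.
  by split=> //; rewrite hE gE; ring.
have {}lG : leading 0 G 1 (u * X * T) by rewrite -gE -hE.
have [t [s lZ]] : exists t s, leading 0
    (usum (fun i => (xs * G ^+ 2) ^+ i.+3 * beta i.+3 ^+ 2)) t s.
  apply: leading_ex => n; apply: (@bounded_size 0 0 3); apply: bounded_usum => i.
  apply: boundedW (boundedM (bounded_y i.+1) (boundedX 2 (bb i.+3))); lia.
have lb := leading_beta 2; have ly := leadingM lx (leadingM lG lG).
have := leadingM (leadingX _) (leadingM lG
  (leadingD (leadingD (leading_u (leadingM (leadingM lx lx) (leadingM lV lV)))
     (leadingM (leadingM ly ly) (leadingM lb lb))) (leading_uM lZ))).
rewrite -[qs * _](_ : V = _); last by rewrite {1}VE usum_recl; ring.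
move=> /(leading_inj lV) [TE SE].
have {}TE : T = X ^+ 2 * (1 + u * T ^+ 2) by rewrite {1}TE; ring.
split=> //; transitivity (X * u * T * (X ^+ 2 * (1 + u * T ^+ 2))
    + 4%:R * X ^+ 3 * u * T + 2%:R * u * X ^+ 2 * T * S).
  by rewrite {1}SE; ring.
by rewrite -TE; ring.
Qed.

End SystemTop.

(** * Catalan numbers and the leading terms *)

Section Catalan.

(** Ballot numbers: the coefficient of [z^n] in [C(z)^(k+1)] is [ballot (2 n + k) n]. *)
Definition ballot N n : rat := 'C(N, n)%:R - (if n is n'.+1 then 'C(N, n')%:R else 0).

Lemma ballotS N n : ballot N.+1 n.+1 = ballot N n.+1 + ballot N n.
Proof.
rewrite /ballot binS natrD; case: n => [|n]; first by rewrite !bin0; ring.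
by rewrite [in X in _ - X]binS natrD; ring.
Qed.

(** The series [c] solving the equation satisfies [c^(k+1) = c^k + z c^(k+2)], which on coefficients
    is Pascal's rule for ballot numbers; so all powers of [c] are computed together. *)
Lemma Cgf_equation : Ps Cgf = 1 + psX rat * Ps Cgf ^+ 2.
Proof.
have [|X [XE _]] := @contraction_fixpoint rat (fun X k => 1 + psX rat * X k ^+ 2).
  by move=> n X Y XY k; apply: eqmD => //; apply/eqm_psXM/eqmX.
move/(_ 0%N): XE; move: (X 0%N) => c /esym cE.
suff <- : c = Ps Cgf by [].
have cS k : c ^+ k.+1 = c ^+ k + psX rat * c ^+ k.+2.
  by rewrite exprS {1}cE !exprS; ring.
have cb n k : cf (c ^+ k.+1) n = ballot (n.*2 + k) n.
  elim: n k => [|n IHn] k.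
    have c0 j : cf (c ^+ j) 0 = 1.
      by elim: j => // j IHj; rewrite cS cfD cfXM0 addr0.
    by rewrite c0 /ballot bin0 subr0.
  elim: k => [|k IHk]; rewrite cS cfD cfXM IHn.
    rewrite addn0 doubleS ballotS addn1 expr0 cf1 [ballot _ n.+1]/ballot.
    have -> : 'C(n.*2.+1, n.+1) = 'C(n.*2.+1, n).
      by rewrite -bin_sub; [congr 'C(_, _); lia|lia].
    by rewrite subrr.
  by rewrite IHk addnS doubleS !addSn addnS -ballotS.
apply: psP => n; rewrite -[c]expr1 cb addn0 -mul2n /Cgf /Cat /ballot.
have n1 : n.+1%:R != 0 :> rat by rewrite pnatr_eq0.
apply: (canRL (mulfK n1)); case: n {n1} => [|n]; first by rewrite bin0 subr0.
have := mul_bin_left (2 * n.+1) n; rewrite (_ : (2 * n.+1 - n)%N = n.+2); last by lia.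
move/(congr1 (fun k => k%:R : rat)); rewrite !natrM => binE.
by rewrite mulrBl [_ * n.+2%:R in X in _ - X]mulrC -binE -(addn1 n.+1) natrD; ring.
Qed.

Lemma Cat0 : Cat 0 = 1. Proof. by rewrite /Cat bin0 divr1. Qed.

Lemma CatS n : Cat n.+1 = \sum_(i < n.+1) Cat i * Cat (n - i).
Proof.
have /(congr1 (fun a => cf a n.+1)) := Cgf_equation.
by rewrite cfD cfXM cf1 add0r.
Qed.

Lemma Cat_gt0 n : 0 < Cat n.
Proof. by rewrite divr_gt0 ?ltr0n // bin_gt0; lia. Qed.

Lemma monomialM (c d : rat) m n :
  (c *: 'X^m) * (d *: 'X^n) = (c * d) *: 'X^(m + n) :> {poly rat}.
Proof. by rewrite -scalerAl -scalerAr scalerA -exprD. Qed.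

Lemma leading_top_coef (T S : ps {poly rat}) :
    T = psC 'X ^+ 2 * (1 + psX _ * T ^+ 2) ->
    S = psC 'X * psX _ * T ^+ 2 + 4%:R * psC 'X ^+ 3 * psX _ * T
        + 2%:R * psX _ * psC 'X ^+ 2 * T * S ->
  (forall n, cf T n = Cat n *: 'X^(4 * n + 2)) /\
  (forall n, cf S n = (if n is 0 then 0 else (3 * n + 2)%:R * Cat n) *: 'X^(4 * n + 1)).
Proof.
move=> TE SE.
have TE' : T = psC ('X ^+ 2) * (1 + psX _ * (T * T)).
  by rewrite {1}TE rmorphXn expr2.
have T_ n : cf T n = Cat n *: 'X^(4 * n + 2).
  elim/ltn_ind: n => n IHn; rewrite TE' cfCM cfD cf1.
  case: n IHn => [|n] IHn; first by rewrite cfXM0 addr0 mulr1 Cat0 scale1r.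
  rewrite cfXM add0r cfM CatS scaler_suml mulr_sumr; apply: eq_bigr => -[i /= iN] _.
  rewrite !IHn; try lia.
  by rewrite monomialM -scalerAr -exprD; congr (_ *: 'X^_); lia.
split=> //.
have SE' : S = psX _ * (psC 'X * (T * T) + psC (4%:R * 'X ^+ 3) * T
    + psC (2%:R * 'X ^+ 2) * (T * S)).
  by rewrite {1}SE (rmorphM _ 4%:R) (rmorphM _ 2%:R) !rmorphXn !rmorph_nat; ring.
elim/ltn_ind=> -[|n] IHn; rewrite SE'; first by rewrite cfXM0 scale0r.
rewrite cfXM !cfD !cfCM !cfM.
pose d j : rat := if j is 0 then 0 else (3 * j + 2)%:R * Cat j.
(* The closed form would give [2] at [j = 0], where [d] vanishes; this defect accounts for the term
   [- Cat n *+ 4] below. *)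
have dE j : d j = (3 * j + 2)%:R * Cat j - (j == 0)%:R *+ 2.
  by case: j => [|j]; rewrite /d ?subr0 // Cat0 mulr1 subrr.
have -> : \sum_(i < n.+1) cf T i * cf T (n - i) = Cat n.+1 *: 'X^(4 * n + 4).
  rewrite CatS scaler_suml; apply: eq_bigr => -[i /= iN] _; rewrite !T_.
  by rewrite monomialM; congr (_ *: 'X^_); lia.
have -> : \sum_(i < n.+1) cf T i * cf S (n - i)
        = (\sum_(i < n.+1) Cat i * d (n - i)%N) *: 'X^(4 * n + 3).
  rewrite scaler_suml; apply: eq_bigr => -[i /= iN] _; rewrite T_ IHn; last by lia.
  by rewrite monomialM; congr (_ *: 'X^_); lia.
have sumd : (\sum_(i < n.+1) Cat i * d (n - i)%N) *+ 2
          = (3 * n + 4)%:R * Cat n.+1 - Cat n *+ 4.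
  have -> : \sum_(i < n.+1) Cat i * d (n - i)%N
     = \sum_(i < n.+1) (3 * (n - i) + 2)%:R * (Cat i * Cat (n - i)) - Cat n *+ 2.
    rewrite (eq_bigr (fun i : 'I_n.+1 => (3 * (n - i) + 2)%:R * (Cat i * Cat (n - i))
       - Cat i * (n - i == 0)%N%:R *+ 2)); last first.
      by move=> i _; rewrite dE; ring.
    rewrite big_split; congr (_ + _).
    rewrite (bigD1 ord_max) //= subnn eqxx mulr1 big1 ?addr0 // => -[i /= iN] /eqP ine.
    rewrite (_ : (_ == _) = false) ?mulr0 ?mul0rn ?oppr0 //; apply/negP => /eqP in0.
    by apply: ine; apply: val_inj => /=; lia.
  rewrite mulrnBl -mulrnA; congr (_ - _).
  (* Adding the sum to its reversal gives the constant weight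
     [(3 i + 2) + (3 (n - i) + 2) = 3 n + 4], and a Catalan convolution remains. *)
  rewrite mulr2n {1}(reindex_inj rev_ord_inj) /= -big_split CatS mulr_sumr.
  apply: eq_bigr => -[i /= iN] _; rewrite subSS subKn; last by lia.
  rewrite [Cat i * _]mulrC -mulrDl -natrD; congr (_%:R * _); lia.
have E (b k m : nat) (a : rat) :
    b%:R * 'X^k * (a *: 'X^m) = (b%:R * a) *: 'X^(k + m) :> {poly rat}.
  by rewrite -scalerAr -mulrA -exprD !mulr_natl -?scalerMnr -?scalerMnl.
rewrite T_ !E -['X * _]mulr1 (_ : 'X * _ * 1 = 1%:R * 'X^1 * (Cat n.+1 *: 'X^(4 * n + 4)));
  last by rewrite expr1 mul1r mulr1.
rewrite E [2%:R * _]mulr_natl sumd.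
rewrite (_ : (1 + (4 * n + 4) = 4 * n.+1 + 1)%N); last by lia.
rewrite (_ : (3 + (4 * n + 2) = 4 * n.+1 + 1)%N); last by lia.
rewrite (_ : (2 + (4 * n + 3) = 4 * n.+1 + 1)%N); last by lia.
rewrite -!scalerDl; congr (_ *: _).
rewrite (_ : (3 * n.+1 + 2 = 3 * n + 4 + 1)%N); last by lia.
by rewrite [(_ + 1)%:R]natrD; ring.
Qed.

End Catalan.

(** * Expansion of the generating functions *)

Lemma system_map (A A' : comNzRingType) (f : {rmorphism A -> A'}) x q V G beta :
  system x q V G beta ->
  system (f x) (f q) (psmap f V) (psmap f G) (fun k => psmap f (beta k)).
Proof.
move=> [GE VE b0 bS]; split=> [|||k].
- by rewrite {1}GE rmorphD !rmorphM rmorph1 /= psmapC psmapX.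
- rewrite {1}VE rmorphM rmorphM rmorphD rmorphM rmorphM !rmorphXn /= !psmapC psmapX.
  congr (_ * (_ + _)); rewrite psmap_usum; apply: eq_usum => i.
  by rewrite rmorphM 2!rmorphXn rmorphM rmorphXn /= psmapC.
- by rewrite b0 rmorph1.
- rewrite bS rmorphD rmorphM /= psmapX psmap_usum; congr (_ + _ * _); apply: eq_usum => i.
  by rewrite 3!rmorphM rmorph_nat rmorphXn rmorphM rmorphXn /= psmapC.
Qed.

Lemma cf_psXnM (A : comNzRingType) n (a : ps A) : cf (psX A ^+ n * a) n = cf a 0.
Proof. by elim: n => [|n IHn]; rewrite ?expr0 ?mul1r // exprS -mulrA cfXM. Qed.

Section Evaluation.
Variables X Q : ps rat.

Definition eval1 : {rmorphism {poly rat} -> ps rat} :=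
  horner_morph (fun c => mulrC X (psC c)).
Definition eval2 : {rmorphism {poly {poly rat}} -> ps rat} :=
  horner_morph (fun p => mulrC Q (eval1 p)).

Lemma cf_eval1 p : cf (eval1 p) = peval p (cf X).
Proof.
apply/funext => n; rewrite /eval1 /= /horner_morph /map_poly horner_poly cf_sum.
by apply: eq_bigr => i _; rewrite cfCM fpowE Ps_cf.
Qed.

Lemma eval2_sum (p : {poly {poly rat}}) N : (size p <= N)%N ->
  eval2 p = \sum_(s < N) eval1 p`_s * Q ^+ s.
Proof.
move=> pN; rewrite [LHS](_ : _ = (map_poly (eval1) p).[Q]) //.
rewrite (@horner_coef_wide _ N); last exact: leq_trans (size_poly _ _) pN.
by apply: eq_bigr => s _; rewrite coef_map.
Qed.

End Evaluation.

Lemma walk_recurrence_expansion B : walk_recurrence (psX rat) B ->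
  cf (B 1%N) 0 = Ps Cgf /\ forall xi, (1 <= xi)%N ->
     exists K : nat -> {poly rat},
       (forall s : nat, (s <= 2 * xi - 2)%N ->
          (forall i : nat, 0 <= (K s)`_i) /\ size (K s) = (2 * xi + s).+1) /\
       (forall n : nat,
          cf (cf (B 1%N) xi) n =
          fmul Cgf
            (fun k => \sum_(s < (2 * xi - 1)%N)
               fmul (peval (K s) (fmul fX (fpow Cgf 2)))
                    (fpow (fgeom (fmul fX (fpow Cgf 2))) s.+1) k) n) /\
       K (2 * xi - 2)%N = Cat (xi - 1) *: 'X^(4 * xi - 2) /\
       ((2 <= xi)%N ->
          K (2 * xi - 3)%N = ((3 * xi - 1)%:R * Cat (xi - 1)) *: 'X^(4 * xi - 3)).
Proof.
move=> recB; have [X XE] : exists X, X = psX rat * Ps Cgf ^+ 2 by exists (psX rat * Ps Cgf ^+ 2).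
have CE : Ps Cgf = 1 + X by rewrite XE; apply: Cgf_equation.
pose Q := Ps (fgeom (cf X)).
have QE : (1 - X) * Q = 1 by apply: fgeomE; rewrite XE cfXM0.
have fXE' : fmul fX (fpow Cgf 2) = cf X by rewrite fmulE fXE fpowE !Ps_cf XE.
rewrite fXE'; have [V [G [beta [sys [bV bG bb]]]]] := polynomial_system_solution.
have := system_map (eval2 X Q) sys.
have -> : eval2 X Q 'X = Q by rewrite /eval2 /= horner_morphX.
have -> : eval2 X Q 'X%:P = X.
  by rewrite /eval2 /= horner_morphC /eval1 /= horner_morphX.
move/(system_walk_recurrence XE CE QE) => [B' recB' B'1].
have {B' recB' B'1} B1 : B 1%N = psC (Ps Cgf) * (1 + psX _ * psmap (eval2 X Q) V).
  by rewrite (walk_recurrence_unique recB recB') B'1.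
split=> [|[//|n] _]; first by rewrite B1 cfCM cfD cfXM0 addr0 cf1 mulr1.
have sV m : (size (cf V m) <= m.*2.+2)%N by rewrite (bounded_size _ bV).
have [T [S lV]] : exists T S, leading 1 V T S.
  by apply: leading_ex => m; rewrite (bounded_size _ bV).
have [TE SE] := leading_system sys bG bb lV.
have [T_ S_] := leading_top_coef TE SE.
have topV m : (cf V m)`_(m.*2.+1) = Cat m *: 'X^(4 * m + 2).
  by rewrite -T_; case: (lV m) => _ <- _.
(* These extremal coefficients make the degrees exact. The edge [s = 0] comes from
   [dom_system_power], the edge [s = 2 m] from the Catalan term, and the interior by the shift from
   [(m, s)] to [(m + 1, s + 1)]. *)
have V_pos s m : (s <= m.*2)%N -> 0 < (cf V m)`_s.+1`_(m.*2 + s + 2).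
  elim: s m => [|s IHs] m sm.
    rewrite addn0.
    apply: lt_le_trans (dom_coef m 1 (m.*2 + 2) (dom_system_power sys bV bG bb m)).
    rewrite (_ : _ * _ = psX _ ^+ m * psC ('X * ('X ^+ (m.*2 + 2))%:P)); last first.
      rewrite exprMn -exprM mul2n rmorphM /= [('X ^+ _)%:P]rmorphXn rmorphXn exprD /=.
      by ring.
    by rewrite /m3 cf_psXnM /= coefXM /= coefC eqxx coefXn eqxx.
  have [sm2|ms] := ltnP s.+1 m.*2; last first.
    have -> : s.+1 = m.*2 by lia.
    rewrite topV coefZ coefXn (_ : (_ == _) = true) ?mulr1 ?Cat_gt0 //; lia.
  case: m sm sm2 => // m sm sm2.
  apply: lt_le_trans (dom_coef m.+1 s.+2 (m.+1.*2 + s.+1 + 2)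
    (dom_system_shift sys bV bG bb)).
  have -> : psC ('X : {poly {poly rat}}) * psC 'X%:P ^+ 3 * (psX _ * V)
      = psX _ * (psC ('X * ('X ^+ 3)%:P) * V).
    by rewrite rmorphM !rmorphXn /= ; ring.
  rewrite m3XM /m3 cfCM -mulrA coefXM /= coefCM coefXnM ifN; last by lia.
  rewrite (_ : (_ - 3)%N = (m.*2 + s + 2)%N); last by lia.
  apply: IHs; lia.
(* [B 1 = C (1 + u V)] makes [n = xi - 1] the index in [V]; as [V] has no term free of [q], the
   powers [q^(s+1)] start at [s = 0]. *)
exists (fun s => (cf V n)`_s.+1); split=> [s sn|].
  split=> [i|]; first exact: (bV _ _ _).1.
  apply/eqP; rewrite eqn_leq; apply/andP; split.
    apply/leq_sizeP => d ld; apply/eqP; apply: contraTT ld => /(bV _ _ _).2 [_ _]; lia.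
  rewrite ltnNge; apply/negP => /leq_sizeP/(_ _ (leqnn _)) V0.
  have := V_pos s n; rewrite (_ : (n.*2 + s + 2 = 2 * n.+1 + s)%N) ?V0 ?ltxx; last by lia.
  by move/(_ ltac:(lia)).
split=> [m|].
  rewrite B1 cfCM cfD cfXM cf1 add0r fmulE; congr (cf (_ * _) m).
  rewrite -[cf (psmap _ _) n]/(eval2 X Q (cf V n)) (@eval2_sum _ _ _ n.*2.+2) //.
  apply: psP => k; rewrite big_ord_recl [X in eval1 _ X](_ : _ = 0).
    rewrite rmorph0 mul0r add0r.
    rewrite cf_sum [RHS]/= (_ : (2 * n.+1 - 1)%N = n.*2.+1); last by lia.
    by apply: eq_bigr => s _; rewrite -cf_eval1 fpowE !fmulE !Ps_cf -exprS lift0.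
  apply/polyP => d; rewrite coef0; apply/eqP; apply/negPn/negP.
  by move/(bV _ _ _).2 => [].
split.
  rewrite (_ : (2 * n.+1 - 2).+1 = n.*2.+1)%N ?topV; last by lia.
  by rewrite subn1; congr (_ *: 'X^_); lia.
move=> n2; rewrite (_ : (2 * n.+1 - 3).+1 = n.*2)%N; last by lia.
case: (lV n) => _ _; rewrite coefXM /= => ->; rewrite S_ subn1.
case: n n2 {S_} => // n _; congr (_%:R * _ *: 'X^_); lia.
Qed.

(** * The series of codes and the theorem *)

Definition codes_series k : ps (ps rat) :=
  if k is k'.+1 then Ps (fun x => Ps (fun l => (ncodes k' x l)%:R)) else 1.

Lemma codes_series_recurrence : walk_recurrence (psX rat) codes_series.
Proof.
split=> // k; apply: psP => x; apply: psP => l.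
rewrite [LHS]/= ncodes_rec natrD !cfD; congr (_ + _).
  by case: k => [|k] //=; case: x l => [|x] [|l].
rewrite cf_usum cf_sum natr_sum; apply: eq_bigr => -[i /= ix] _.
have zM m (a : ps rat) j : cf (psX rat ^+ m * a) j = if (j < m)%N then 0 else cf a (j - m)%N.
  elim: m j => [|m IHm] j; first by rewrite expr0 mul1r subn0.
  by case: j => [|j]; rewrite exprS -mulrA ?cfXM0 // cfXM IHm ltnS.
transitivity (cf (cf (psC ('C(i + k, i)%:R * psX rat ^+ i.+1)
    * (codes_series i.+1 * codes_series (i + k).+1)) (x - i)) l); last first.
  by rewrite rmorphM rmorph_nat rmorphXn !mulrA.
rewrite cfCM natrM -mulrA.
have natM m (a : ps rat) j : cf (m%:R * a) j = m%:R * cf a j.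
  by rewrite -(rmorph_nat (@psC rat)) cfCM.
rewrite natM zM; congr (_ * _); case: ltnP => il.
  rewrite big1 // => x1 _; rewrite (_ : (l - i = 0)%N) ?big_ord0 //; lia.
rewrite cfM cf_sum natr_sum; apply: eq_bigr => x1 _; rewrite cfM natr_sum.
have -> : (l - i = (l - i.+1).+1)%N by lia.
by apply: eq_bigr => l1 _; rewrite natrM.
Qed.

Lemma Wgf_codes_series xi l : Wgf xi l = cf (cf (codes_series 1%N) xi) l.
Proof.
rewrite /Wgf [RHS]/=; case: leqP => xl.
  rewrite tree_walk_count // natrM mulfK // pnatr_eq0 -lt0n fact_gt0 //.
(* For [l < xi] both sides vanish: by [nvert_excess] a code of excess [xi] with [l] edges would have
   no vertex. *)
rewrite /ncodes; case E : (codes _ _ _ _) => [//|c s].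
have : c \in codes l 0 xi l by rewrite E mem_head.
rewrite mem_codes // => /and4P [_ _ /eqP ce /eqP cl].
by have := nvert_excess c; have := nvert_gt0 c; lia.
Qed.

Theorem theorem1 :
  (forall n : nat, Wgf 0 n = Cgf n) /\
  (forall xi : nat, (1 <= xi)%N ->
     exists K : nat -> {poly rat},
       (forall s : nat, (s <= 2 * xi - 2)%N ->
          (forall i : nat, 0 <= (K s)`_i) /\ size (K s) = (2 * xi + s).+1) /\
       (forall n : nat,
          Wgf xi n =
          fmul Cgf
            (fun k => \sum_(s < (2 * xi - 1)%N)
               fmul (peval (K s) (fmul fX (fpow Cgf 2)))
                    (fpow (fgeom (fmul fX (fpow Cgf 2))) s.+1) k) n) /\
       K (2 * xi - 2)%N = Cat (xi - 1) *: 'X^(4 * xi - 2) /\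
       ((2 <= xi)%N ->
          K (2 * xi - 3)%N = ((3 * xi - 1)%:R * Cat (xi - 1)) *: 'X^(4 * xi - 3))).
Proof.
have [W0 Wxi] := walk_recurrence_expansion codes_series_recurrence.
split=> [n|xi /Wxi [K [Kpos [KE Ktop]]]]; first by rewrite Wgf_codes_series W0.
by exists K; split=> //; split=> // n; rewrite Wgf_codes_series KE.
Qed.
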